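(* Let $w$ be a nonnegative integer and $u$ an indeterminate. Then \[ \sum_{\lambda:\lambda_1 \le 2w} \left( u^{c(\lambda)} + u^{2w-c(\lambda)} \right) s_{\lambda}(\mathbf{x}) = \frac{1}{2} \sum_{k=0}^w \left( u^k + u^{2w-k} \right) \det_{1 \le i, j \le w} \left( \begin{cases} f_{i-j}(\mathbf{x}) + f_{i+j-2}(\mathbf{x}), &\text{if } 1 \le i \le w-k, \\ f_{i-j+1}(\mathbf{x}) + f_{i+j-1}(\mathbf{x}), &\text{if } w-k+1 \le i \le w, \end{cases} \right), \] \[ \sum_{\lambda:\lambda_1 \le 2w} \left( u^{c(\lambda)} - u^{2w-c(\lambda)} \right) s_{\lambda}(\mathbf{x}) = e(\mathbf{x}) \overline{e}(\mathbf{x}) \sum_{k=0}^{w-1} \left( u^k - u^{2w-k} \right) \det_{1 \le i, j \le w-1} \left( \begin{cases} f_{i-j}(\mathbf{x}) - f_{i+j}(\mathbf{x}), &\text{if } 1 \le i \le w-k-1, \\ f_{i-j+1}(\mathbf{x}) - f_{i+j+1}(\mathbf{x}), &\text{if } w-k \le i \le w-1, \end{cases} \right), \] \[ \sum_{\lambda:\lambda_1 \le 2w+1} \left( u^{c(\lambda)} + u^{2w+1-c(\lambda)} \right) s_{\lambda}(\mathbf{x}) = e(\mathbf{x}) \sum_{k=0}^w \left( u^k + u^{2w+1-k} \right) \det_{1 \le i, j \le w} \left( \begin{cases} f_{i-j}(\mathbf{x}) - f_{i+j-1}(\mathbf{x}), &\text{if } 1 \le i \le w-k, \\ f_{i-j+1}(\mathbf{x})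 - f_{i+j}(\mathbf{x}), &\text{if } w-k+1 \le i \le w, \end{cases} \right), \] and \[ \sum_{\lambda:\lambda_1 \le 2w+1} \left( u^{c(\lambda)} - u^{2w+1-c(\lambda)} \right) s_{\lambda}(\mathbf{x}) = \overline{e}(\mathbf{x}) \sum_{k=0}^w \left( u^k - u^{2w+1-k} \right) \det_{1 \le i, j \le w} \left( \begin{cases} f_{i-j}(\mathbf{x}) + f_{i+j-1}(\mathbf{x}), &\text{if } 1 \le i \le w-k, \\ f_{i-j+1}(\mathbf{x}) + f_{i+j}(\mathbf{x}), &\text{if } w-k+1 \le i \le w, \end{cases} \right). \]
   Context: Symmetric functions are in infinitely many variables $\mathbf{x}=(x_1,x_2,\dots)$ (formal power series). The sums on the left range over all partitions $\lambda$ (including the empty one) with largest part $\lambda_1$ bounded as indicated; $s_\lambda(\mathbf{x})$ is the Schur function. For a partition $\lambda$ with conjugate $\lambda'$, $c(\lambda)$ denotes the number of columns of odd length, i.e. the number of $j$ with $\lambda'_j$ odd. $e_n(\mathbf{x})$ is the $n$-th elementary symmetric function ($e_0=1$, $e_n=0$ for $n<0$), $f_r(\mathbf{x})=\sum_{n\in\mathbb{Z}} e_n(\mathbf{x})e_{n+r}(\mathbf{x})$ for $r\in\mathbb{Z}$, $e(\mathbf{x})=\sum_{n\ge0}e_n(\mathbf{x})$ and $\overline{e}(\mathbf{x})=\sum_{n\ge0}(-1)^ne_n(\mathbf{x})$. The determinant of an empty ($0\times 0$) matrix is $1$.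
   Formalization: The first identity is stated only for w ≥ 1, because at w = 0 it is false as printed (left side 2, right side 1); the other three identities hold for all w ≥ 0. *)

(* Defs.v *)
From HB Require Import structures.
From mathcomp Require Import all_boot all_order all_algebra finmap.
From mathcomp.multinomials Require Import monalg.
From mathcomp Require Import boolp classical_sets functions cardinality fsbigop.

Set Implicit Arguments.
Unset Strict Implicit.
Unset Printing Implicit Defensive.

Import Order.TTheory GRing.Theory.

Local Open Scope classical_set_scope.
Local Open Scope ring_scope.

Definition factorizations (I : choiceType) (m : {cmonom I}) :
    set ({cmonom I} * {cmonom I}) :=
  [set p | mmul p.1 p.2 = m].

Lemma monom_eq (I : choiceType) (m1 m2 : {cmonom I}) :
  (forall i, m1 i = m2 i) -> m1 = m2.
Proof. by move=> h; apply/eqP/cmP. Qed.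

Lemma mmulI (I : choiceType) (m : {cmonom I}) : injective (mmul m).
Proof.
move=> m1 m2 eqm; apply: monom_eq => i; apply/eqP.
by rewrite -(eqn_add2l (m i)) -!cmM eqm.
Qed.

Lemma le_mdeg (I : choiceType) (m : {cmonom I}) i : (m i <= mdeg m)%N.
Proof.
by rewrite mdegE; case: mdomP => // im; rewrite (big_fsetD1 i) //= leq_addr.
Qed.

Lemma finite_bounded_monom (I : choiceType) (X : {fset I}) (d : nat) :
  finite_set [set m : {cmonom I} | (finsupp m `<=` X)%fset /\
                                   forall i, (m i <= d)%N].
Proof.
pose g (h : {ffun X -> 'I_d.+1}) : {cmonom I} :=
  mkcmonom [fsfun i : X => nat_of_ord (h i) | 0%N].
apply: (@sub_finite_set _ _ (g @` setT)); last exact/finite_image/finite_finset.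
move=> m [sm le_md]; exists [ffun i => inord (m (val i))] => //.
apply: monom_eq => i; rewrite cmE fsfun_ffun.
case: insubP => [u iX <-|iX] /=; first by rewrite ffunE inordK // ltnS.
by apply/esym/eqP; rewrite cmE_eq0; apply: contra iX => /(fsubsetP sm).
Qed.

Lemma finite_factorizations (I : choiceType) (m : {cmonom I}) :
  finite_set (factorizations m).
Proof.
pose B := [set a : {cmonom I} | (finsupp a `<=` finsupp m)%fset /\
                                forall i, (a i <= mdeg m)%N].
have finB : finite_set B by apply: finite_bounded_monom.
apply: (@sub_finite_set _ _ (B `*` B)); last exact: finite_setX.
move=> -[a b] /= abm; split; split => [|i] /=; rewrite -abm ?mdomD.
- exact: fsubsetUl.
- by apply: leq_trans (le_mdeg _ i); rewrite cmM leq_addr.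
- exact: fsubsetUr.
- by apply: leq_trans (le_mdeg _ i); rewrite cmM leq_addl.
Qed.

(* Formal power series in the (possibly infinitely many) commuting variables
   x_i, i : I, given by the family of their coefficients. *)
Record series (I : choiceType) (R : Type) :=
  Series { coef : {cmonom I} -> R }.

HB.instance Definition _ (I : choiceType) (R : Type) :=
  gen_eqMixin (series I R).
HB.instance Definition _ (I : choiceType) (R : Type) :=
  gen_choiceMixin (series I R).

Lemma seriesP (I : choiceType) (R : Type) (f g : series I R) :
  (forall m, coef f m = coef g m) -> f = g.
Proof. by case: f g => [f] [g] /= /funext ->. Qed.

Section SeriesRing.
Context {I : choiceType} {R : comNzRingType}.
Implicit Types (f g h : series I R) (m : {cmonom I}) (c : R).

Definition series_zero : series I R := Series (fun=> 0).
Definition series_opp f := Series (fun m => - coef f m).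
Definition series_add f g := Series (fun m => coef f m + coef g m).
Definition series_one : series I R := Series (fun m => (m == mone)%:R).
Definition series_mul f g :=
  Series (fun m => \sum_(p \in factorizations m) coef f p.1 * coef g p.2).
Definition series_scale c f := Series (fun m => c * coef f m).

Fact series_addA : associative series_add.
Proof. by move=> f g h; apply: seriesP => m /=; rewrite addrA. Qed.

Fact series_addC : commutative series_add.
Proof. by move=> f g; apply: seriesP => m /=; rewrite addrC. Qed.

Fact series_add0 : left_id series_zero series_add.
Proof. by move=> f; apply: seriesP => m /=; rewrite add0r. Qed.

Fact series_addN : left_inverse series_zero series_opp series_add.
Proof. by move=> f; apply: seriesP => m /=; rewrite addNr. Qed.

HB.instance Definition _ := GRing.isZmodule.Build (series I R)
  series_addA series_addC series_add0 series_addN.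

Let fz m := fset_set (factorizations m).

Let in_fz m p : (p \in fz m) = (mmul p.1 p.2 == m).
Proof.
rewrite in_fset_set; last exact: finite_factorizations.
by apply/idP/eqP; rewrite inE.
Qed.

Let mulE f g m :
  coef (series_mul f g) m = \sum_(p <- fz m) coef f p.1 * coef g p.2.
Proof. by rewrite /= fsbig_finite //; exact: finite_factorizations. Qed.

Let fz_assoc (V : nmodType) m (F : {cmonom I} -> {cmonom I} -> {cmonom I} -> V) :
  \sum_(p <- fz m) \sum_(q <- fz p.1) F q.1 q.2 p.2 =
  \sum_(p <- fz m) \sum_(q <- fz p.2) F p.1 q.1 q.2.
Proof.
pose G (t : {cmonom I} * {cmonom I} * {cmonom I}) := F t.1.1 t.1.2 t.2.
transitivity (\sum_(t <- [seq (q, p.2) | p <- fz m, q <- fz p.1]) G t).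
  by rewrite big_allpairs_dep.
transitivity (\sum_(t <- [seq (p.1, q.1, q.2) | p <- fz m, q <- fz p.2]) G t);
  last by rewrite big_allpairs_dep.
apply: perm_big; apply: uniq_perm.
- apply: allpairs_uniq_dep => [|p _|]; try exact: fset_uniq.
  move=> _ _ /allpairsPdep[p [q [pm qp ->]]] /allpairsPdep[p' [q' [pm' qp' ->]]] /=.
  case: p p' q q' {pm pm'} qp qp' => [a b] [a' b'] [c d] [c' d'].
  by rewrite !in_fz /= => /eqP<- /eqP<- [-> -> ->].
- apply: allpairs_uniq_dep => [|p _|]; try exact: fset_uniq.
  move=> _ _ /allpairsPdep[p [q [pm qp ->]]] /allpairsPdep[p' [q' [pm' qp' ->]]] /=.
  case: p p' q q' {pm pm'} qp qp' => [a b] [a' b'] [c d] [c' d'].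
  by rewrite !in_fz /= => /eqP<- /eqP<- [-> -> ->].
move=> [[a b] c]; apply/allpairsPdep/allpairsPdep.
- move=> [[p1 p2] [[q1 q2] []]]; rewrite !in_fz /= => /eqP<- /eqP<- [-> -> ->].
  by exists (q1, mmul q2 p2), (q2, p2); rewrite !in_fz /= mulmA !eqxx.
- move=> [[p1 p2] [[q1 q2] []]]; rewrite !in_fz /= => /eqP<- /eqP<- [-> -> ->].
  by exists (mmul p1 q1, q2), (p1, q1); rewrite !in_fz /= mulmA !eqxx.
Qed.

Fact series_mulA : associative series_mul.
Proof.
move=> f g h; apply: seriesP => m; rewrite !mulE.
under eq_bigr => p _ do rewrite mulE big_distrr /=.
under [RHS]eq_bigr => p _ do rewrite mulE big_distrl /=.
rewrite -(fz_assoc m (fun m1 m2 m3 => coef f m1 * (coef g m2 * coef h m3))).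
by apply: eq_bigr => p _; apply: eq_bigr => q _; rewrite mulrA.
Qed.

Fact series_mulC : commutative series_mul.
Proof.
move=> f g; apply: seriesP => m; rewrite !mulE.
have swapK : involutive (fun p : {cmonom I} * {cmonom I} => (p.2, p.1)) by case.
rewrite [RHS](perm_big (map (fun p => (p.2, p.1)) (fz m))) /=.
  by rewrite big_map; apply: eq_bigr => p _; rewrite mulrC.
apply: uniq_perm; rewrite ?(map_inj_uniq (inv_inj swapK)) ?fset_uniq // => -[a b].
apply/idP/mapP => [abm|[[c d]]]; last first.
  by rewrite !in_fz /= mulmC => cdm [-> ->].
by exists (b, a) => //; move: abm; rewrite !in_fz mulmC.
Qed.

Fact series_mul1 : left_id series_one series_mul.
Proof.
move=> f; apply: seriesP => m; rewrite mulE.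
rewrite (bigD1_seq (mone, m)) ?fset_uniq ?in_fz ?mul1m //= eqxx mul1r.
rewrite big_seq_cond big1 ?addr0 // => -[a b]; rewrite in_fz /= => /andP[/eqP<-].
by have [->|] := eqVneq a mone; rewrite ?mul1m ?eqxx ?mul0r.
Qed.

Fact series_mulDl : left_distributive series_mul series_add.
Proof.
move=> f g h; apply: seriesP => m; rewrite mulE.
transitivity (coef (series_mul f h) m + coef (series_mul g h) m) => //.
by rewrite !mulE -big_split; apply: eq_bigr => p _; rewrite /= mulrDl.
Qed.

Fact series_oner_neq0 : series_one != 0.
Proof.
by apply/eqP => /(congr1 (fun f => coef f mone))/eqP; rewrite /= eqxx oner_eq0.
Qed.

HB.instance Definition _ := GRing.Zmodule_isComNzRing.Build (series I R)
  series_mulA series_mulC series_mul1 series_mulDl series_oner_neq0.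

Fact series_scaleA a b f :
  series_scale a (series_scale b f) = series_scale (a * b) f.
Proof. by apply: seriesP => m /=; rewrite mulrA. Qed.

Fact series_scale1 : left_id 1 series_scale.
Proof. by move=> f; apply: seriesP => m /=; rewrite mul1r. Qed.

Fact series_scaleDr : right_distributive series_scale +%R.
Proof. by move=> c f g; apply: seriesP => m /=; rewrite mulrDr. Qed.

Fact series_scaleDl f : {morph series_scale^~ f : a b / a + b}.
Proof. by move=> a b; apply: seriesP => m /=; rewrite mulrDl. Qed.

HB.instance Definition _ := GRing.Zmodule_isLmodule.Build R (series I R)
  series_scaleA series_scale1 series_scaleDr series_scaleDl.

Fact series_scaleAl c f g : c *: (f * g) = (c *: f) * g.
Proof.
apply: seriesP => m; transitivity (c * coef (series_mul f g) m) => //.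
transitivity (coef (series_mul (series_scale c f) g) m) => //.
by rewrite !mulE big_distrr; apply: eq_bigr => p _; rewrite /= mulrA.
Qed.

HB.instance Definition _ := GRing.Lmodule_isLalgebra.Build R (series I R)
  series_scaleAl.

HB.instance Definition _ := GRing.Lalgebra_isComAlgebra.Build R (series I R).

Lemma coef0 m : coef (0 : series I R) m = 0. Proof. by []. Qed.
Lemma coefN f m : coef (- f) m = - coef f m. Proof. by []. Qed.
Lemma coefD f g m : coef (f + g) m = coef f m + coef g m. Proof. by []. Qed.
Lemma coef1 m : coef (1 : series I R) m = (m == mone)%:R. Proof. by []. Qed.
Lemma coefZ c f m : coef (c *: f) m = c * coef f m. Proof. by []. Qed.
Lemma coefM f g m :
  coef (f * g) m = \sum_(p \in factorizations m) coef f p.1 * coef g p.2.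
Proof. by []. Qed.

End SeriesRing.

Section InfiniteSums.
Context {I : choiceType} {R : comNzRingType}.

Definition summable (T : choiceType) (A : set T) (F : T -> series I R) : Prop :=
  forall m, finite_set [set t | A t /\ coef (F t) m <> 0].

(* Meaningful for summable families only: \sum_(t \in A) is 0 by convention when
   infinitely many terms are nonzero.  All the families summed below are
   summable, see the lemmas summable_*.  *)
Definition isum (T : choiceType) (A : set T) (F : T -> series I R) :
    series I R :=
  Series (fun m => \sum_(t \in A) coef (F t) m).

Definition xmonom (m : {cmonom I}) : series I R :=
  Series (fun m' => (m' == m)%:R).

Definition xvar (i : I) : series I R := xmonom (ucm i).

Definition homog (n : nat) (f : series I R) : Prop :=
  forall m, coef f m <> 0 -> mdeg m = n.

End InfiniteSums.

Notation "\isum_ ( i '\in' A ) F" := (isum A (fun i => F))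
  (at level 41, F at level 41, i name, A at level 60,
   format "'[' \isum_ ( i  '\in'  A ) '/  '  F ']'") : ring_scope.

(* Determinant with rows and columns indexed by 1, ..., n. *)
Definition det1 (R : pzRingType) (n : nat) (A : nat -> nat -> R) : R :=
  \det (\matrix_(i < n, j < n) A i.+1 j.+1).

Notation "'\det_' ( 1 <= i , j <= n ) E" := (det1 n (fun i j => E))
  (at level 41, E at level 41, i name, j name, n at level 70,
   format "'[' '\det_' ( 1  <=  i ,  j  <=  n ) '/  '  E ']'") : ring_scope.

(* Partitions are nonincreasing lists of positive parts; the empty list is the
   empty partition. *)
Definition is_partition (l : seq nat) : bool := sorted geq l && (0%N \notin l).

Definition largest_part (l : seq nat) : nat := head 0%N l.

(* The list lambda'_1, ..., lambda'_(lambda_1). *)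
Definition conj_part (l : seq nat) : seq nat :=
  [seq count (leq j) l | j <- iota 1 (largest_part l)].

Definition odd_cols (l : seq nat) : nat := count odd (conj_part l).

(* A tableau is the list of its rows; zip cuts a row down to the length of the
   row below it, so that r and s are compared column by column. *)
Definition is_ssyt (l : seq nat) (t : seq (seq nat)) : bool :=
  [&& shape t == l, all (sorted leq) t
    & sorted (fun r s => all (fun p => p.1 < p.2)%N (zip r s)) t].

(* The variables are x_0, x_1, x_2, ... *)
Section SymmetricFunctions.
Context {R : comNzRingType}.

Definition schur (l : seq nat) : series nat R :=
  \isum_(t \in [set t | is_ssyt l t]) \prod_(r <- t) \prod_(i <- r) xvar i.

Definition elemn (n : nat) : series nat R :=
  \isum_(S \in [set S : {fset nat} | #|` S| = n]) \prod_(i <- S) xvar i.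

Definition elem (n : int) : series nat R :=
  match n with Posz k => elemn k | Negz _ => 0 end.

Definition fser (r : int) : series nat R :=
  \isum_(n \in [set: int]) (elem n * elem (n + r)).

Definition eser : series nat R := \isum_(n \in [set: nat]) elem n%:Z.

Definition ebarser : series nat R :=
  \isum_(n \in [set: nat]) ((-1) ^+ n * elem n%:Z).

End SymmetricFunctions.

Lemma fsum_neq0 (T : choiceType) (V : nmodType) (A : set T) (F : T -> V) :
  \sum_(t \in A) F t <> 0 -> exists2 t, A t & F t <> 0.
Proof.
apply: contra_notP => /forall2NP F0; apply: fsbig1 => t At.
by case: (F0 t) => // /contrapT.
Qed.

Lemma xmonom1 (I : choiceType) (R : comNzRingType) : xmonom mone = 1 :> series I R.
Proof. by []. Qed.

Lemma xmonomM (I : choiceType) (R : comNzRingType) (a b : {cmonom I}) :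
  xmonom (mmul a b) = xmonom a * xmonom b :> series I R.
Proof.
apply: seriesP => m; rewrite coefM /=.
have [->|neq] := eqVneq m (mmul a b).
  rewrite (fsbigE [:: (a, b)]) //=.
  - by rewrite big_cons big_nil !eqxx mem_set //= addr0 mulr1.
  - by move=> p /=; rewrite inE => /eqP ->.
  - move=> [c d] _; rewrite inE xpair_eqE negb_and /=.
    by case/orP => /negPf ->; rewrite ?mul0r ?mulr0.
rewrite fsbig1 // => -[c d] /= cdm; move: neq; rewrite -cdm.
have [->|] := eqVneq c a; last by rewrite mul0r.
by have [->|] := eqVneq d b; rewrite ?eqxx // mulr0.
Qed.

Lemma prod_xvar (I : choiceType) (R : comNzRingType) (s : seq I) :
  \prod_(i <- s) xvar i = xmonom (\big[mmul/mone]_(i <- s) ucm i) :> series I R.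
Proof.
elim: s => [|i s IHs]; first by rewrite !big_nil xmonom1.
by rewrite !big_cons IHs xmonomM.
Qed.

Lemma coef_prod_xvar (I : choiceType) (R : comNzRingType) (s : seq I) m :
  coef (\prod_(i <- s) xvar i : series I R) m <> 0 ->
  mdeg m = size s /\ {subset s <= finsupp m}.
Proof.
rewrite prod_xvar /=; case: eqP => // -> _; split.
  by rewrite mdeg_prod; under eq_bigr do rewrite mdegU; rewrite sum1_size.
elim: s => // i s IHs j; rewrite inE big_cons mdomD in_fsetU mdomU in_fset1.
by case/orP => [->|/IHs ->]; rewrite ?orbT.
Qed.

Lemma homogM (I : choiceType) (R : comNzRingType) n k (f g : series I R) :
  homog n f -> homog k g -> homog (n + k) (f * g).
Proof.
move=> fn gk m; rewrite coefM => /fsum_neq0[[a b] /= <- fg0].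
rewrite mdegM (fn a) ?(gk b) //; first by move=> g0; case: fg0; rewrite g0 mulr0.
by move=> f0; case: fg0; rewrite f0 mul0r.
Qed.

Lemma homog_isum (I T : choiceType) (R : comNzRingType) n (A : set T)
    (F : T -> series I R) :
  (forall t, A t -> homog n (F t)) -> homog n (isum A F).
Proof. by move=> hF m /fsum_neq0[t At /(hF t At)]. Qed.

Lemma homog_elemn (R : comNzRingType) n : homog n (@elemn R n).
Proof. by apply: homog_isum => S /= <- m /coef_prod_xvar[]. Qed.

Lemma homog_schur (R : comNzRingType) l : homog (sumn l) (@schur R l).
Proof.
apply: homog_isum => t /= /and3P[/eqP <- _ _] m.
by rewrite -big_flatten => /coef_prod_xvar[-> _]; rewrite size_flatten.
Qed.

Lemma summable_elemn (R : comNzRingType) n :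
  summable [set S : {fset nat} | #|` S| = n]
           (fun S => \prod_(i <- S) xvar i : series nat R).
Proof.
move=> m; apply: (@sub_finite_set _ _ [set` fpowerset (finsupp m)]);
  last exact: finite_fset.
move=> S /= [_ /coef_prod_xvar[_ sSm]]; rewrite fpowersetE.
exact/fsubsetP.
Qed.

Lemma summable_schur (R : comNzRingType) l :
  summable [set t | is_ssyt l t]
           (fun t => \prod_(r <- t) \prod_(i <- r) xvar i : series nat R).
Proof.
move=> m; pose g (s : (sumn l).-tuple (finsupp m)) := reshape l (map val s).
apply: (@sub_finite_set _ _ (g @` setT)); last exact/finite_image/finite_finset.
move=> t /= [/and3P[/eqP tl _ _]]; rewrite -big_flatten.
move=> /coef_prod_xvar[_ stm].
have sz : size (pmap insub (flatten t) : seq (finsupp m)) == sumn l.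
  rewrite size_pmap_sub -tl -size_flatten -all_count.
  by apply/allP.
exists (Tuple sz) => //; rewrite /g /=.
suff -> : map val (pmap insub (flatten t) : seq (finsupp m)) = flatten t.
  by rewrite -tl flattenK.
elim: (flatten t) stm {tl sz} => //= i s IHs stm.
have im : i \in finsupp m by apply: stm; rewrite mem_head.
by rewrite insubT /= IHs // => j js; apply: stm; rewrite inE js orbT.
Qed.

Lemma coef_elem (R : comNzRingType) (n : int) m :
  coef (@elem R n) m <> 0 -> n = (mdeg m)%:Z.
Proof. by case: n => n //= /homog_elemn ->. Qed.

Lemma summable_eser (R : comNzRingType) :
  summable [set: nat] (fun n => @elem R n%:Z).
Proof.
move=> m; apply: (@sub_finite_set _ _ [set mdeg m]); last exact: finite_set1.
by move=> n [_ /(@coef_elem R n%:Z)[->]].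
Qed.

Lemma summable_ebarser (R : comNzRingType) :
  summable [set: nat] (fun n => (-1) ^+ n * @elem R n%:Z).
Proof.
move=> m; apply: (@sub_finite_set _ _ [set mdeg m]); last exact: finite_set1.
move=> n [_]; rewrite -signr_odd mulr_sign.
case: (odd n) => [|/(@coef_elem R n%:Z)[->] //].
by rewrite coefN => /eqP; rewrite oppr_eq0 => /eqP/(@coef_elem R n%:Z)[->].
Qed.

Lemma summable_fser (R : comNzRingType) (r : int) :
  summable [set: int] (fun n => @elem R n * elem (n + r)).
Proof.
move=> m; pose A := [set Posz k | k in `I_(mdeg m).+1].
apply: (@sub_finite_set _ _ A); last exact/finite_image/finite_II.
move=> n [_]; rewrite coefM => /fsum_neq0[[a b] /= abm ab0].
exists (mdeg a); first by rewrite /= -abm mdegM ltnS leq_addr.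
by apply/esym/(@coef_elem R) => a0; apply: ab0; rewrite a0 mul0r.
Qed.

Lemma finite_partitions n : finite_set [set l | is_partition l /\ sumn l = n].
Proof.
pose g (s : n.-bseq 'I_n.+1) := [seq nat_of_ord i | i <- s].
apply: (@sub_finite_set _ _ (g @` setT)); last exact/finite_image/finite_finset.
move=> l /= [/andP[_ l0] ln].
have szl : (size l <= n)%N.
  rewrite -ln; elim: l l0 {ln} => //= x l IHl; rewrite inE negb_or eq_sym.
  by rewrite -lt0n => /andP[x0 /IHl]; rewrite -add1n; apply: leq_add.
have lel x : x \in l -> (x < n.+1)%N.
  rewrite ltnS -ln; elim: l {l0 ln szl} => //= y l IHl.
  rewrite inE => /orP[/eqP->|/IHl xl]; first exact: leq_addr.
  exact: leq_trans xl (leq_addl _ _).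
have sz : (size [seq inord x : 'I_n.+1 | x <- l] <= n)%N by rewrite size_map.
exists (Bseq sz) => //; rewrite /g /= -map_comp -[RHS]map_id.
by apply/eq_in_map => x /lel xn; rewrite /= inordK.
Qed.

Lemma summable_schur_sum (R : comNzRingType) (A : set (seq nat))
    (c : seq nat -> R) :
  A `<=` [set l | is_partition l] -> summable A (fun l => c l *: schur l).
Proof.
move=> partA m; apply: sub_finite_set (finite_partitions (mdeg m)).
move=> l [/partA lA]; rewrite coefZ => cl0; split=> //.
by apply/esym/(@homog_schur R) => l0; apply: cl0; rewrite l0 mulr0.
Qed.

(* Main.v *)
Require Import Defs.
From HB Require Import structures.
From mathcomp Require Import fingroup perm.
From mathcomp Require Import all_boot all_order all_algebra finmap.
From mathcomp.multinomials Require Import monalg.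
From mathcomp Require Import boolp classical_sets functions cardinality fsbigop.
From mathcomp Require Import zify ring.

Set Implicit Arguments.
Unset Strict Implicit.
Unset Printing Implicit Defensive.

Import Order.TTheory GRing.Theory Num.Theory.

Local Open Scope classical_set_scope.
Local Open Scope ring_scope.

(* Write N for the bound on lambda_1.  By the dual Jacobi-Trudi formula s_lambda is a minor of the
   Toeplitz matrix (e_(a-j)) with N columns, whose rows form a strictly increasing sequence q.  The
   weight u^c(lambda) is absorbed by treating u as one more variable: after that only the sequences
   q of alternating parity survive, with a sign recording the parity of q_0.

   A sum of minors over all q of alternating parity is a Pfaffian of the skew form with entries
   sgn(b-a) for a, b of different parity, bordered by t rows (sigma^a) with sigma = 1 or -1, which
   produce the factors e and ebar (t = 0, 2, 1, 1 in the four identities).  Pulled back along the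
   Toeplitz matrix this form is again Toeplitz, with symbol Q such that Q(d+1) - Q(d-1) = 2 f_d.  On
   the basis (z+1)(z^i +- z^(-i-t)), (z-1)(z^i +- z^(-i-t)) it is block off-diagonal, and the
   Pfaffian is a determinant with entries f_(i-j) +- f_(i+j+t).  All universal constants are found
   by evaluating both sides at e = (1, 0, 0, ...).

   Finally f_d of the enlarged set of variables is (1+u^2) f_d + u (f_(d-1) + f_(d+1)), so the
   determinant becomes a tridiagonal combination of rows, and expanding it gives the sum over k. *)

(** * The Cauchy-Binet formula *)

(** Every sequence q can be raised to a sequence of alternating parity in exactly two ways, one for
    each parity of the first entry, moving c(lambda) or N - c(lambda) rows up by one. This is why
    u^c and u^(N-c) occur together; the sign between them is the product of the sigma. The border is
    decoupled from the Pfaffian because evaluation at sigma kills the reflected basis, which amounts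
    to sigma^t = -sgn.

    The ring consists of power series, so nothing can be divided: an identity obtained up to a
    constant is useful only if that constant can be cancelled. The unknown determinant of the change
    of basis and the unknown alternating Pfaffian enter on one side only and are eliminated together
    by the normalization. What remains is a power of 4, a Vandermonde determinant and the sum
    attached to the standard symplectic form; positivity of the last makes absence of torsion
    sufficient. Pfaffians appear as unnormalized sums over pairs of index maps, so that their
    properties reduce to multilinearity of determinants. Truncation to n variables makes e_k vanish
    for k > n and all matrices finite. *)

Definition strict (N B : nat) (q : 'I_N -> 'I_B) : bool :=
  [forall i : 'I_N, forall j : 'I_N, (i < j)%N ==> (q i < q j)%N].

Lemma strictP (N B : nat) (q : 'I_N -> 'I_B) :
  reflect {homo q : i j / (i < j)%N >-> (i < j)%N} (strict q).
Proof.
apply: (iffP forallP) => [h i j ij|h i]; first by have /forallP/(_ j)/implyP := h i; apply.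
by apply/forallP => j; apply/implyP; apply: h.
Qed.

Lemma strict_mono (N B : nat) (q : 'I_N -> 'I_B) : strict q ->
  {mono q : i j / (i < j)%N >-> (i < j)%N}.
Proof.
move=> /strictP h i j; case: (ltngtP i j) => [|/h|/val_inj ->]; rewrite ?ltnn //; first exact: h.
by move=> /ltnW; rewrite leqNgt => /negbTE.
Qed.

Lemma strict_inj (N B : nat) (q : 'I_N -> 'I_B) : strict q -> injective q.
Proof.
move=> /strict_mono h i j eq; apply/val_inj; case: (ltngtP i j) => //;
  by rewrite -h eq ltnn.
Qed.

Section Rank.
Variables (N B : nat).
Implicit Type f : {ffun 'I_N -> 'I_B}.

Definition rank f (i : 'I_N) := #|[pred j | (f j < f i)%N]|.

Lemma rank_subproof f i : (rank f i < N)%N.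
Proof.
rewrite -[X in (_ < X)%N]card_ord; apply: proper_card; apply/properP; split.
  exact: subset_predT.
by exists i; rewrite // !inE ltnn.
Qed.

Definition rank_fun f : {ffun 'I_N -> 'I_N} := [ffun i => Ordinal (rank_subproof f i)].
(** For a non-injective [f] the ranks form no permutation and [insubd] falls back on the identity;
    the definition carries information for injective [f] only. *)
Definition rank_perm f : 'S_N := insubd (1%g : 'S_N) (rank_fun f).
Definition sorted_fun f : {ffun 'I_N -> 'I_B} := [ffun i => f ((rank_perm f)^-1%g i)].

Lemma rank_lt f i j : (f i < f j)%N -> (rank f i < rank f j)%N.
Proof.
move=> ij; apply: proper_card; apply/properP; split.
  by apply/fintype.subsetP => k; rewrite !inE => /ltn_trans; apply.
by exists i; rewrite ?inE ?ltnn.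
Qed.

Lemma rank_perm_val f i : injective f -> rank_perm f i = rank f i :> nat.
Proof.
move=> injf; have inj : injectiveb (rank_fun f).
  apply/injectiveP => x y /(congr1 val); rewrite !ffunE /= => rxy; apply: injf.
  apply/val_inj; case: (ltngtP (f x) (f y)) => // /rank_lt; rewrite rxy ltnn //.
rewrite /rank_perm -pvalE (_ : pval _ = rank_fun f) ?ffunE //.
exact: insubdK.
Qed.

Lemma strict_sorted_fun f : injective f -> strict (sorted_fun f).
Proof.
move=> injf; apply/strictP => k l kl; rewrite !ffunE.
set i := ((rank_perm f)^-1%g k); set j := ((rank_perm f)^-1%g l).
have ri : rank f i = k by rewrite -rank_perm_val // permKV.
have rj : rank f j = l by rewrite -rank_perm_val // permKV.
rewrite ltnNge leq_eqVlt; apply/norP; split.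
  by apply/eqP => /val_inj/injf ji; rewrite -ri -rj ji ltnn in kl.
apply/negP => /rank_lt; rewrite ri rj => /ltnW; by rewrite leqNgt kl.
Qed.

Lemma sorted_funK f : [ffun i => sorted_fun f (rank_perm f i)] = f.
Proof. by apply/ffunP => i; rewrite !ffunE permK. Qed.

Lemma rank_perm_comp (q : {ffun 'I_N -> 'I_B}) (s : 'S_N) :
  strict q -> rank_perm [ffun i => q (s i)] = s.
Proof.
move=> sq; have injq := strict_inj sq.
apply/perm.permP => i; apply/val_inj; rewrite /= rank_perm_val; last first.
  by move=> x y; rewrite !ffunE => /injq /perm_inj.
have -> : (s i : nat) = (\sum_(k < s i) 1)%N by rewrite sum_nat_const card_ord muln1.
rewrite /rank (big_ord_widen N (fun=> 1%N)) 1?ltnW // (reindex_inj (@perm_inj _ s)).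
by rewrite -sum1_card; apply: eq_bigl => j; rewrite !inE !ffunE strict_mono.
Qed.

Lemma sorted_fun_comp (q : {ffun 'I_N -> 'I_B}) (s : 'S_N) :
  strict q -> sorted_fun [ffun i => q (s i)] = q.
Proof. by move=> sq; apply/ffunP => i; rewrite !ffunE rank_perm_comp // permKV. Qed.

(** An injective map is a strict one precomposed with a permutation, and
    [(sorted_fun f, rank_perm f)] recovers both factors. *)
Lemma sum_injective (V : nmodType) (G : {ffun 'I_N -> 'I_B} -> V) :
  \sum_(f : {ffun 'I_N -> 'I_B} | injectiveb f) G f =
  \sum_(q : {ffun 'I_N -> 'I_B} | strict q) \sum_(s : 'S_N) G [ffun i => q (s i)].
Proof.
rewrite pair_big_dep /= (reindex_onto (fun x : {ffun 'I_N -> 'I_B} * 'S_N => [ffun i => x.1 (x.2 i)])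
  (fun f => (sorted_fun f, rank_perm f))) /=; last by move=> f _; exact: sorted_funK.
apply: eq_bigl => -[q s] /=; rewrite andbT; apply/andP/idP => [[injf /eqP[<- _]]|sq].
  exact/strict_sorted_fun/injectiveP.
rewrite sorted_fun_comp // rank_perm_comp // eqxx; split=> //.
by apply/injectiveP => x y; rewrite !ffunE => /(strict_inj sq) /perm_inj.
Qed.

End Rank.

(** Expanding the rows of the product gives a sum over all maps [f]. A non-injective [f] repeats a
    row of [T]; the injective ones are grouped by their increasing rearrangement. *)
Lemma Cauchy_Binet (R : comNzRingType) (N B : nat) (M : 'M[R]_(N, B)) (T : 'M[R]_(B, N)) :
  \det (M *m T) =
  \sum_(q : {ffun 'I_N -> 'I_B} | strict q) \det (colsub q M) * \det (rowsub q T).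
Proof.
pose G (f : {ffun 'I_N -> 'I_B}) := \prod_i M i (f i) * \det (rowsub f T).
transitivity (\sum_f G f).
  rewrite /determinant; under eq_bigr => s _.
    under eq_bigr => i _ do rewrite mxE.
    rewrite bigA_distr_bigA big_distrr /=.
    over.
  rewrite exchange_big; apply: eq_bigr => f _ /=.
  rewrite /G big_distrr; apply: eq_bigr => s _; rewrite /= big_split /= mulrCA.
  by congr (_ * (_ * _)); apply: eq_bigr => i _; rewrite mxE.
rewrite (bigID (fun f : {ffun 'I_N -> 'I_B} => injectiveb f)) /= [X in _ + X]big1 ?addr0; last first.
  move=> f /injectivePn[i [j ij fij]].
  by rewrite /G (determinant_alternate ij) ?mulr0 // => k; rewrite !mxE fij.
rewrite sum_injective; apply: eq_bigr => q _.
rewrite [\det (colsub q M)]/determinant big_distrl; apply: eq_bigr => s _ /=.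
rewrite /G; under eq_bigr do rewrite ffunE.
have -> : rowsub [ffun i => q (s i)] T = perm_mx s *m rowsub q T.
  by rewrite -row_permE; apply/matrixP => i j; rewrite !mxE ffunE.
rewrite det_mulmx det_perm mulrA; congr (_ * _); rewrite mulrC.
by congr (_ * _); apply: eq_bigr => i _; rewrite mxE.
Qed.
(** * Pfaffian sums of minors *)

Section PairSum.
Variable R : comNzRingType.

(** Multilinearity in the first 2m rows only; the border [Z] is carried along. *)
Lemma det_mul_rows (m t B : nat) (U V : 'M[R]_(m, B)) (T : 'M[R]_(B, m + (m + t)))
    (Z : 'M[R]_(t, m + (m + t))) :
  \det (col_mx (U *m T) (col_mx (V *m T) Z)) =
  \sum_(a : {ffun 'I_m -> 'I_B}) \sum_(b : {ffun 'I_m -> 'I_B})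
    (\prod_i U i (a i)) * (\prod_i V i (b i)) *
    \det (col_mx (rowsub a T) (col_mx (rowsub b T) Z)).
Proof.
rewrite /determinant; transitivity (\sum_(a : {ffun 'I_m -> 'I_B}) \sum_(b : {ffun 'I_m -> 'I_B})
    \sum_(s : 'S_(m + (m + t))) (\prod_i U i (a i)) * (\prod_i V i (b i)) *
    ((-1) ^+ s * \prod_i col_mx (rowsub a T) (col_mx (rowsub b T) Z) i (s i))); last first.
  by apply: eq_bigr => a _; apply: eq_bigr => b _; rewrite big_distrr.
under [RHS]eq_bigr => a _ do rewrite exchange_big /=.
rewrite [RHS]exchange_big /=; apply: eq_bigr => s _.
have prodE (P Q : 'M[R]_(m, m + (m + t))) : \prod_i col_mx P (col_mx Q Z) i (s i) =
    \prod_i P i (s (lshift _ i)) * (\prod_i Q i (s (rshift _ (lshift _ i))) *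
    \prod_i Z i (s (rshift _ (rshift _ i)))).
  rewrite !big_split_ord /=; congr (_ * (_ * _)); apply: eq_bigr => i _.
  - by rewrite col_mxEu.
  - by rewrite col_mxEd col_mxEu.
  - by rewrite !col_mxEd.
have distr (W : 'M[R]_(m, B)) (h : 'I_m -> 'I_(m + (m + t))) :
    \prod_i (W *m T) i (h i) =
    \sum_(a : {ffun 'I_m -> 'I_B}) \prod_i W i (a i) * \prod_i T (a i) (h i).
  under eq_bigr do rewrite mxE.
  by rewrite bigA_distr_bigA; apply: eq_bigr => a _; rewrite big_split.
rewrite prodE !distr !big_distrl big_distrr /=; apply: eq_bigr => a _.
rewrite !big_distrr /=; apply: eq_bigr => b _.
rewrite prodE.
have rowE (f : {ffun 'I_m -> 'I_B}) (h : 'I_m -> 'I_(m + (m + t))) :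
    \prod_i rowsub f T i (h i) = \prod_i T (f i) (h i) by apply: eq_bigr => i _; rewrite mxE.
rewrite !rowE [RHS]mulrCA -!mulrA; congr (_ * (_ * _)).
by rewrite mulrCA.
Qed.

(* For t = 0 and T the identity this is, up to sign, 2^m m! times the Pfaffian of (A - A^T)/2; the
   rows of Z stand for indices that are left unpaired. *)
Definition pairsum (m t B : nat) (A : 'M[R]_B) (Z : 'M[R]_(t, m + (m + t)))
    (T : 'M[R]_(B, m + (m + t))) : R :=
  \sum_(a : {ffun 'I_m -> 'I_B}) \sum_(b : {ffun 'I_m -> 'I_B})
    (\prod_i A (a i) (b i)) * \det (col_mx (rowsub a T) (col_mx (rowsub b T) Z)).

Lemma pairsum_mulr (m t B : nat) (A : 'M[R]_B) (Z : 'M[R]_(t, m + (m + t)))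
    (T : 'M[R]_(B, m + (m + t))) (C : 'M[R]_(m + (m + t))) :
  pairsum A (Z *m C) (T *m C) = \det C * pairsum A Z T.
Proof.
rewrite /pairsum big_distrr; apply: eq_bigr => a _; rewrite big_distrr.
apply: eq_bigr => b _ /=; rewrite mulrCA; congr (_ * _).
by rewrite -!mul_rowsub_mx -!mul_col_mx det_mulmx mulrC.
Qed.

(** A substitution in the rows is absorbed by the form as a congruence. Since [S] may be
    rectangular, this covers restriction of the form as well as change of basis. *)
Lemma pairsum_mull (m t B B' : nat) (A : 'M[R]_B) (Z : 'M[R]_(t, m + (m + t)))
    (S : 'M[R]_(B, B')) (T : 'M[R]_(B', m + (m + t))) :
  pairsum A Z (S *m T) = pairsum (S^T *m A *m S) Z T.
Proof.
rewrite /pairsum.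
transitivity (\sum_(a : {ffun 'I_m -> 'I_B}) \sum_(b : {ffun 'I_m -> 'I_B})
  \sum_(c : {ffun 'I_m -> 'I_B'}) \sum_(d : {ffun 'I_m -> 'I_B'})
  (\prod_i (A (a i) (b i) * S (a i) (c i) * S (b i) (d i))) *
   \det (col_mx (rowsub c T) (col_mx (rowsub d T) Z))).
  apply: eq_bigr => a _; apply: eq_bigr => b _.
  rewrite -!mul_rowsub_mx det_mul_rows big_distrr; apply: eq_bigr => c _.
  rewrite big_distrr; apply: eq_bigr => d _ /=.
  rewrite !mulrA !big_split /=; congr (_ * _ * _ * _); by apply: eq_bigr => i _; rewrite mxE.
under eq_bigr => a _ do rewrite exchange_big /=.
rewrite exchange_big /=; apply: eq_bigr => c _.
under eq_bigr => a _ do rewrite exchange_big /=.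
rewrite exchange_big /=; apply: eq_bigr => d _.
under eq_bigr => a _ do rewrite -big_distrl /=.
rewrite -big_distrl /=; congr (_ * _).
under [RHS]eq_bigr => i _ do rewrite mxE.
under [RHS]eq_bigr => i _ do under eq_bigr => k _ do rewrite mxE big_distrl /=.
under [RHS]eq_bigr => i _ do rewrite exchange_big /=.
rewrite bigA_distr_bigA; apply: eq_bigr => a _ /=.
rewrite bigA_distr_bigA; apply: eq_bigr => b _ /=.
by apply: eq_bigr => i _; rewrite mxE [_ * A _ _]mulrC.
Qed.

Lemma pairsum_mulZ (m t B : nat) (A : 'M[R]_B) (D : 'M[R]_t) (Z : 'M[R]_(t, m + (m + t)))
    (T : 'M[R]_(B, m + (m + t))) :
  pairsum A (D *m Z) T = \det D * pairsum A Z T.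
Proof.
rewrite /pairsum big_distrr; apply: eq_bigr => a _; rewrite big_distrr.
apply: eq_bigr => b _ /=; rewrite mulrCA; congr (_ * _).
set X := rowsub a T; set Y := rowsub b T.
transitivity (\det (block_mx 1%:M 0 0 (block_mx 1%:M 0 0 D) *m col_mx X (col_mx Y Z))).
  by rewrite !mul_block_col !mul1mx !mul0mx !add0r !addr0.
by rewrite det_mulmx !det_ublock !det1 !mul1r.
Qed.

(** The minor summation formula. The selected rows and the border are a single matrix times [T], so
    Cauchy-Binet splits off the minors of [T]; the cofactor of the minor [q] is the same kind of sum
    for the form restricted to [q]. *)
Lemma pairsum_strict (m t B : nat) (A : 'M[R]_B) (chi : 'M[R]_(t, B))
    (T : 'M[R]_(B, m + (m + t))) :
  pairsum A (chi *m T) T =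
  \sum_(q : {ffun 'I_(m + (m + t)) -> 'I_B} | strict q)
    pairsum (mxsub q q A) (colsub q chi) 1%:M * \det (rowsub q T).
Proof.
transitivity (\sum_(q : {ffun 'I_(m + (m + t)) -> 'I_B} | strict q)
   pairsum A (colsub q chi) (colsub q 1%:M) * \det (rowsub q T)).
  rewrite /pairsum; under [RHS]eq_bigr => q _ do rewrite big_distrl /=.
  under [RHS]eq_bigr => q _ do under eq_bigr => a _ do rewrite big_distrl /=.
  rewrite [RHS]exchange_big; apply: eq_bigr => a _ /=.
  rewrite [RHS]exchange_big; apply: eq_bigr => b _ /=.
  under [RHS]eq_bigr => q _ do rewrite -mulrA.
  rewrite -big_distrr /=; congr (_ * _).
  transitivity (\det (col_mx (rowsub a 1%:M) (col_mx (rowsub b 1%:M) chi) *m T)).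
    by rewrite !mul_col_mx -!rowsubE.
  rewrite Cauchy_Binet; apply: eq_bigr => q _; congr (\det _ * _).
  apply/matrixP => i j; rewrite mxE; case: (split_ordP i) => k ->.
    by rewrite !col_mxEu !mxE.
  by rewrite !col_mxEd; case: (split_ordP k) => l ->; rewrite ?col_mxEu ?col_mxEd !mxE.
apply: eq_bigr => q _; congr (_ * _).
(* Selecting the columns [q] of the identity is the substitution that restricts the form to [q]. *)
rewrite -[X in pairsum _ _ X]mulmx1 pairsum_mull; congr pairsum.
apply/matrixP => i j; rewrite mxE (bigD1 (q j)) //= big1 ?addr0 => [|k kj]; last first.
  by rewrite !mxE (negbTE kj) mulr0.
rewrite !mxE eqxx mulr1 (bigD1 (q i)) //= big1 ?addr0 => [|k ki]; last first.
  by rewrite !mxE (negbTE ki) mul0r.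
by rewrite !mxE eqxx mul1r.
Qed.

End PairSum.

(** * Evaluation of the sum for a block off-diagonal form *)

Section PairSumOffDiagonal.
Variables (R : comNzRingType) (m t : nat).

Lemma pairsum_addZ B (A : 'M[R]_B) (Z : 'M[R]_(t, m + (m + t)))
    (T : 'M[R]_(B, m + (m + t))) (W : 'M[R]_(B, t)) :
  pairsum A Z (T + W *m Z) = pairsum A Z T.
Proof.
apply: eq_bigr => a _; apply: eq_bigr => b _; congr (_ * _).
transitivity (\det (block_mx 1%:M (row_mx 0 (rowsub a W)) 0
    (block_mx 1%:M (rowsub b W) 0 1%:M) *m col_mx (rowsub a T) (col_mx (rowsub b T) Z))).
  rewrite !mul_block_col mul_row_col !mul1mx !mul0mx !add0r.
  by rewrite !mul_rowsub_mx; congr (\det (col_mx _ (col_mx _ _)));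
    apply/matrixP => i j; rewrite !mxE.
by rewrite det_mulmx !det_ublock !det1 !mul1r.
Qed.

(** The transposition preserves the form and the border, but its matrix has determinant -1. *)
Lemma pairsum_tperm (M : 'M[R]_(m + (m + t))) (Z : 'M[R]_(t, m + (m + t)))
    (x y : 'I_(m + (m + t))) : x != y ->
  (forall i j, M (tperm x y i) (tperm x y j) = M i j) ->
  (forall i j, Z i (tperm x y j) = Z i j) ->
  pairsum M Z 1%:M = - pairsum M Z 1%:M.
Proof.
move=> xy HM HZ; set P := tperm_mx x y : 'M[R]_(m + (m + t)).
have PM (k : nat) (U : 'M[R]_(k, m + (m + t))) : U *m P = colsub (tperm x y) U.
  by rewrite -col_permEsub col_permE tpermV.
have ZP : Z *m P = Z by rewrite PM; apply/matrixP => i j; rewrite mxE HZ.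
have tP : P^T = P by rewrite /P tr_tperm_mx.
have MP : P^T *m M *m P = M.
  rewrite PM tP /P -row_permE; apply/matrixP => i j; rewrite !mxE.
  exact: HM.
rewrite -{1}MP -pairsum_mull mulmx1 -{1}ZP -{2}[P]mul1mx pairsum_mulr.
by rewrite det_perm odd_tperm xy expr1 mulN1r.
Qed.

Definition symplectic : 'M[R]_(m + (m + t)) :=
  block_mx 0 (row_mx 1%:M 0) (col_mx (- 1%:M) 0) 0.

Definition last_rows : 'M[R]_(t, m + (m + t)) := row_mx 0 (row_mx 0 1%:M).

(** The border can clear the last t coordinates of the paired rows, so the entries of [M] there drop
    out. What remains is the pullback of [symplectic] along diag(G, 1, 1), which produces the
    determinant of [G] without inverting it. *)
Lemma pairsum_offdiag (M : 'M[R]_(m + (m + t))) (X : 'M[R]_t) (G : 'M[R]_m) :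
  (forall i j, M (lshift _ i) (lshift _ j) = 0) ->
  (forall i j, M (rshift _ (lshift _ i)) (rshift _ (lshift _ j)) = 0) ->
  (forall i j, M (lshift _ i) (rshift _ (lshift _ j)) = G i j) ->
  (forall i j, M (rshift _ (lshift _ j)) (lshift _ i) = - G i j) ->
  pairsum M (row_mx 0 (row_mx 0 X)) 1%:M =
    \det X * \det G * pairsum symplectic last_rows 1%:M.
Proof.
move=> M00 M11 M01 M10.
have -> : row_mx 0 (row_mx 0 X) = X *m last_rows.
  by rewrite /last_rows !mul_mx_row !mulmx0 mulmx1.
rewrite pairsum_mulZ -mulrA; congr (_ * _).
pose E : 'M[R]_(m + (m + t)) := block_mx 1%:M 0 0 (block_mx 1%:M 0 0 0).
pose W : 'M[R]_(m + (m + t), t) := col_mx 0 (col_mx 0 1%:M).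
(* [E] is the identity with its last t coordinates cleared; the difference is a multiple of the
   border. *)
rewrite [X in pairsum _ _ X = _](_ : 1%:M = E + W *m last_rows); last first.
  rewrite /E /W /last_rows mul_col_row !mul0mx mulmx0 mul_col_row !mul0mx mulmx0 mul1mx.
  by rewrite !add_block_mx !addr0 !add0r -!scalar_mx_block.
rewrite pairsum_addZ -[E]mulmx1 pairsum_mull.
pose D : 'M[R]_(m + (m + t)) := block_mx G 0 0 1%:M.
have MB : M = block_mx 0 (row_mx G (rsubmx (ursubmx M))) (col_mx (- G^T) (dsubmx (dlsubmx M)))
    (block_mx 0 (ursubmx (drsubmx M)) (dlsubmx (drsubmx M)) (drsubmx (drsubmx M))).
  rewrite -[LHS]submxK -[drsubmx M in LHS]submxK -[ursubmx M in LHS]hsubmxK.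
  rewrite -[dlsubmx M in LHS]vsubmxK; congr block_mx.
  - by apply/matrixP => i j; rewrite !mxE M00.
  - by congr row_mx; apply/matrixP => i j; rewrite !mxE M01.
  - by congr col_mx; apply/matrixP => i j; rewrite !mxE M10.
  - by congr block_mx; apply/matrixP => i j; rewrite !mxE M11.
have -> : E^T *m M *m E = D^T^T *m symplectic *m D^T.
  rewrite trmxK MB /D /E /symplectic !tr_block_mx !trmx0 !trmx1.
  rewrite !mulmx_block.
  rewrite !(mul0mx, mulmx0, mul1mx, mulmx1, add0r, addr0, mul_mx_row, mul_col_mx).
  rewrite !(mul_row_block, mul_block_col) !(mul0mx, mulmx0, mul1mx, mulmx1, add0r, addr0).
  rewrite ?mulmx_block !(mul0mx, mulmx0, mul1mx, mulmx1, add0r, addr0, mulNmx, mul1mx).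
  by rewrite !mul_row_col !(mul0mx, mulmx0, mul1mx, add0r, addr0) !row_mx0 !col_mx0.
rewrite -pairsum_mull mulmx1.
have {1}<- : last_rows *m D^T = last_rows.
  rewrite /D tr_block_mx !trmx0 trmx1 /last_rows mul_row_block !(mul0mx, mulmx1, addr0).
  by rewrite mulmx0 !add0r.
by rewrite -[D^T]mul1mx mul1mx -[X in pairsum _ _ X]mul1mx pairsum_mulr det_tr det_ublock det1 mulr1.
Qed.

Lemma sqr_det_rowsub1 (f : 'I_m -> 'I_m) :
  exists k : nat, (\det (rowsub f 1%:M : 'M[R]_m)) ^+ 2 = k%:R.
Proof.
have [/injectiveP injf|/injectivePn[i [j ij fij]]] := boolP (injectiveb f); last first.
  by exists 0; rewrite (determinant_alternate ij) ?expr0n // => k; rewrite !mxE fij.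
exists 1; suff -> : rowsub f 1%:M = perm_mx (perm injf) :> 'M[R]_m.
  by rewrite det_perm sqrr_sign.
by apply/matrixP => i j; rewrite !mxE permE.
Qed.

Lemma symplecticP (x y : 'I_(m + (m + t))) : symplectic x y != 0 ->
  exists kb : 'I_m * bool, symplectic x y = (-1) ^+ kb.2 /\
    (x, y) = if kb.2 then (rshift _ (lshift _ kb.1), lshift _ kb.1)
             else (lshift _ kb.1, rshift _ (lshift _ kb.1)).
Proof.
rewrite /symplectic; case: (split_ordP x) => i ->; case: (split_ordP y) => j ->.
- by rewrite block_mxEul mxE eqxx.
- rewrite block_mxEur; case: (split_ordP j) => k ->; rewrite ?row_mxEl ?row_mxEr mxE ?eqxx //.
  case: (i =P k) => [->|_]; rewrite ?mulr1n ?mulr0n ?eqxx // => _.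
  by exists (k, false); rewrite expr0.
- rewrite block_mxEdl; case: (split_ordP i) => k ->; rewrite ?col_mxEu ?col_mxEd !mxE ?eqxx //.
  case: (k =P j) => [->|_]; rewrite ?mulr1n ?mulr0n ?oppr0 ?eqxx // => _.
  by exists (j, true); rewrite expr1.
- by rewrite block_mxEdr mxE eqxx.
Qed.

(* A nonzero term picks, for each i, one of the pairs (k, k') or (k', k) of conjugate indices; its
   sign cancels the sign of the swaps, and the same square determinant is left for both halves. *)
Lemma pairsum_symplectic_term (a b : {ffun 'I_m -> 'I_(m + (m + t))}) :
  exists k : nat, (\prod_i symplectic (a i) (b i)) *
    \det (col_mx (rowsub a 1%:M) (col_mx (rowsub b 1%:M) last_rows)) = k%:R.
Proof.
have [/forallP h|/forallPn[i /negPn/eqP i0]] :=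
  boolP [forall i, symplectic (a i) (b i) != 0]; last first.
  by exists 0; rewrite (bigD1 i) //= i0 !mul0r.
have [f hf] := fin_all_exists (fun i => symplecticP (h i)).
(* [P] lists the chosen pairs, [S] marks those taken in reverse order, and [Y] below performs these
   swaps between the two halves. *)
pose P : 'M[R]_m := rowsub (fun i => (f i).1) 1%:M.
pose S : 'M[R]_m := diag_mx (\row_i ((f i).2%:R)).
have [k hk] := sqr_det_rowsub1 (fun i => (f i).1); exists k; rewrite -hk -/P.
pose Q : 'M[R]_(m + (m + t)) := block_mx P 0 0 (block_mx P 0 0 1%:M).
pose Y : 'M[R]_(m + (m + t)) := block_mx (1%:M - S) (row_mx S 0) (col_mx S 0)
  (block_mx (1%:M - S) 0 0 1%:M).
have -> : col_mx (rowsub a 1%:M) (col_mx (rowsub b 1%:M) last_rows) = Y *m Q.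
  rewrite /Y /Q mulmx_block !(mulmx0, add0r, addr0).
  rewrite mul_row_block mul_col_mx mulmx_block !(mul0mx, mulmx0, add0r, addr0, mulmx1).
  have SP : S *m P = \matrix_(i, j) ((f i).2 && ((f i).1 == j))%:R.
    apply/matrixP => i j; rewrite mul_diag_mx !mxE -natrM mulnb; by case: (f i).2.
  have SP' : (1%:M - S) *m P = \matrix_(i, j) (~~ (f i).2 && ((f i).1 == j))%:R.
    apply/matrixP => i j; rewrite mulmxBl mul1mx SP !mxE.
    by case: (f i).2; rewrite /= ?subrr ?subr0.
  rewrite SP SP' {SP SP'}; apply/matrixP => i j.
  have [ra rb] : (forall i, a i = if (f i).2 then rshift _ (lshift _ (f i).1) else lshift _ (f i).1) /\
      (forall i, b i = if (f i).2 then lshift _ (f i).1 else rshift _ (lshift _ (f i).1)).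
    by split=> k'; case: (hf k') => _; case: (f k') => x [] [].
  case: (split_ordP i) => {}i ->; [|case: (split_ordP i) => {}i ->];
  (case: (split_ordP j) => {}j ->; [|case: (split_ordP j) => {}j ->]);
  rewrite ?(col_mxEu, col_mxEd, block_mxEul, block_mxEur, block_mxEdl, block_mxEdr, row_mxEl, row_mxEr) ?mxE
    ?ra ?rb //; by case: (f i) => x [] /=; rewrite ?eq_shift.
(* Adding the second block column to the first, then subtracting the first block row from the
   second, makes [Y] triangular with nontrivial diagonal block 1 - 2S: the signs. *)
pose L : 'M[R]_(m + (m + t)) := block_mx 1%:M 0 (col_mx (- 1%:M) 0) 1%:M.
pose U : 'M[R]_(m + (m + t)) := block_mx 1%:M 0 (col_mx 1%:M 0) 1%:M.
have detY : \det Y = \prod_i (-1) ^+ (f i).2.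
  transitivity (\det (L *m (Y *m U))).
    by rewrite !det_mulmx !det_lblock !det1 !mulr1 mul1r.
  have -> : L *m (Y *m U) = block_mx 1%:M (row_mx S 0) 0 (block_mx (1%:M - S - S) 0 0 1%:M).
    rewrite /L /Y /U !mulmx_block !(mulmx0, mul0mx, add0r, addr0, mul1mx, mulmx1).
    rewrite !(mul_row_col, mul_row_block, mul_col_mx, mul_mx_row) !(mulmx0, mul0mx, add0r, addr0, mul1mx, mulmx1).
    rewrite ?(mul_block_col, mul_block_row, mul_col_row) ?(mulmx0, mul0mx, add0r, addr0, mul1mx, mulmx1).
    rewrite subrK mulmx1 mulNmx mul1mx !add_col_mx !addr0 [S + _]addrC subrK addNr col_mx0.
    by rewrite !add_row_mx !addr0 add0r [- S + _]addrC.
  rewrite !det_ublock !det1 mulr1 mul1r.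
  have -> : 1%:M - S - S = diag_mx (\row_i (-1) ^+ (f i).2).
    apply/matrixP => i j; rewrite !mxE; case: eqP => [->|] /=; rewrite ?mulr1n ?mulr0n; last by rewrite !subr0.
    by case: (f j).2; rewrite ?expr1 ?expr0 /= ?subr0 // subrr sub0r.
  by rewrite det_diag; apply: eq_bigr => i _; rewrite mxE.
rewrite det_mulmx detY mulrA -big_split /= big1 => [|i _]; last first.
  by case: (hf i) => -> _; rewrite -expr2 sqrr_sign.
by rewrite mul1r /Q !det_ublock det1 mulr1.
Qed.

(** All pairs taken in order contribute 1 and every other term is a natural number. Positivity is
    what allows this constant to be cancelled in a torsion-free ring. *)
Lemma pairsum_symplectic :
  exists k : nat, pairsum symplectic last_rows 1%:M = k.+1%:R.
Proof.
pose a0 := [ffun i : 'I_m => lshift (m + t) i].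
pose b0 := [ffun i : 'I_m => rshift m (lshift t i)].
rewrite /pairsum pair_big /= (bigD1 (a0, b0)) //=.
have -> : \prod_i symplectic (a0 i) (b0 i) = 1.
  rewrite big1 // => i _; rewrite !ffunE /symplectic block_mxEur row_mxEl mxE eqxx //.
have -> : col_mx (rowsub a0 1%:M) (col_mx (rowsub b0 1%:M) last_rows) = 1%:M.
  apply/matrixP => i j.
  case: (split_ordP i) => {}i ->; [|case: (split_ordP i) => {}i ->];
  (case: (split_ordP j) => {}j ->; [|case: (split_ordP j) => {}j ->]);
  rewrite ?(col_mxEu, col_mxEd, block_mxEul, block_mxEur, block_mxEdl, block_mxEdr, row_mxEl, row_mxEr) ?mxE
    ?ffunE ?eq_shift //.
rewrite det1 mulr1.
have [k ->] : exists k : nat, \sum_(p | p != (a0, b0)) (\prod_i symplectic (p.1 i) (p.2 i)) *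
    \det (col_mx (rowsub p.1 1%:M) (col_mx (rowsub p.2 1%:M) last_rows)) = k%:R.
  apply: (big_ind (fun x : R => exists k : nat, x = k%:R)) => [|x y [k ->] [l ->]|[a b] _]; first by exists 0.
    by exists (k + l)%N; rewrite natrD.
  exact: pairsum_symplectic_term.
by exists k; rewrite mulrS.
Qed.

End PairSumOffDiagonal.
Lemma sum_delta (R : comNzRingType) (F : nat -> R) M p : (p < M)%N ->
  \sum_(k < M) F k * (k == p :> nat)%:R = F p.
Proof.
move=> pM; rewrite (bigD1 (Ordinal pM)) //= eqxx mulr1 big1 ?addr0 // => k kp.
by rewrite (_ : (k == p :> nat) = false) ?mulr0 //; apply/negbTE.
Qed.

(** * The skew Toeplitz form *)

Section Toeplitz.
Variable R : comNzRingType.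
Implicit Types (e : nat -> R) (z : int).

Definition ext e z : R := if z is Posz k then e k else 0.

(** Vanishing on even differences makes neighbours of equal parity interchangeable; it also leaves a
    central difference supported at 0, from which the f_d arise. *)
Definition sgodd z : R := if odd `|z| then (if (0 < z)%R then 1 else -1) else 0.

Lemma sgodd_step z : sgodd (z + 1) - sgodd (z - 1) = (z == 0)%:R *+ 2.
Proof.
rewrite /sgodd; have [->|z0] := eqVneq z 0; first by rewrite /= opprK.
have -> : odd `|z + 1| = odd `|z - 1| by lia.
case: ifP => [h|_]; last by rewrite subrr mul0rn.
have -> : (0 < z + 1)%R = (0 < z - 1)%R by lia.
by rewrite subrr mul0rn.
Qed.

Lemma sgoddN z : sgodd (- z) = - sgodd z.
Proof.
rewrite /sgodd abszN; case: ifP => [h|_]; last by rewrite oppr0.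
have -> : (0 < - z)%R = ~~ (0 < z)%R by lia.
by case: (0 < z)%R; rewrite /= ?opprK.
Qed.

Section FiniteSupport.
Variables (n : nat) (e : nat -> R).
Hypothesis e_fin : forall k, (n < k)%N -> e k = 0.

Definition corr z : R := \sum_(k < n.+1) e k * ext e (k%:Z + z).

(** The symbol Q of the form pulled back along the Toeplitz matrix of [e]. *)
Definition sgcorr z : R :=
  \sum_(k < n.+1) \sum_(l < n.+1) e k * e l * sgodd (z + l%:Z - k%:Z).

Lemma sgcorrN z : sgcorr (- z) = - sgcorr z.
Proof.
rewrite /sgcorr exchange_big -sumrN; apply: eq_bigr => k _; rewrite -sumrN.
apply: eq_bigr => l _ /=; rewrite -mulrN -sgoddN [e l * _]mulrC; congr (_ * sgodd _).
lia.
Qed.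

Lemma ext_sum z : ext e z = \sum_(k < n.+1) e k * (k%:Z == z)%:R.
Proof.
case: z => [k|k] /=; last by rewrite big1 // => l _; rewrite mulr0.
have [kn|nk] := leqP k n.
  rewrite (bigD1 (Ordinal (kn : k < n.+1)%N)) //= eqxx mulr1 big1 ?addr0 // => l lk.
  by rewrite eqz_nat (_ : (l == k :> nat) = false) ?mulr0 //; apply/negbTE.
rewrite e_fin // big1 // => l _; rewrite eqz_nat (_ : (l == k :> nat) = false) ?mulr0 //.
by apply/eqP => lk; move: (ltn_ord l); rewrite lk ltnS leqNgt nk.
Qed.

Lemma sgcorr_step z : sgcorr (z + 1) - sgcorr (z - 1) = corr z *+ 2.
Proof.
rewrite /sgcorr -sumrB; under eq_bigr => k _ do rewrite -sumrB.
rewrite exchange_big /= /corr -sumrMnl; apply: eq_bigr => l _ /=.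
rewrite ext_sum mulr_sumr -sumrMnl; apply: eq_bigr => k _ /=.
rewrite -mulrBr.
have -> : z + 1 + l%:Z - k%:Z = (z + l%:Z - k%:Z) + 1 by lia.
have -> : z - 1 + l%:Z - k%:Z = (z + l%:Z - k%:Z) - 1 by lia.
rewrite sgodd_step -mulrnAr [e k * e l]mulrC -mulrA -mulrnAr.
by congr (_ * (_ * (_%:R *+ _))); rewrite subr_eq0 eq_sym addrC.
Qed.

(** Twice [corr] is the central difference of the odd function [sgcorr], hence even; the 2 is then
    cancelled. *)
Lemma corrN z : (forall k (x : R), x *+ k.+1 = 0 -> x = 0) -> corr (- z) = corr z.
Proof.
move=> torsion_free; apply/eqP; rewrite -subr_eq0; apply/eqP/(@torsion_free 1).
rewrite mulrnBl -!sgcorr_step.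
have -> : - z + 1 = - (z - 1) by clear; lia.
have -> : - z - 1 = - (z + 1) by clear; lia.
by rewrite !sgcorrN opprK [- _ + _]addrC subrr.
Qed.

Lemma sum_ext (F : nat -> R) x B : (x + n < B)%N ->
  \sum_(c < B) F c * ext e (c%:Z - x%:Z) = \sum_(k < n.+1) F (k + x)%N * e k.
Proof.
move=> xB; under eq_bigr => c _ do rewrite ext_sum big_distrr /=.
rewrite exchange_big; apply: eq_bigr => k _ /=.
have kxB : (k + x < B)%N by have := ltn_ord k; lia.
rewrite (bigD1 (Ordinal kxB)) //= big1 ?addr0 => [|c ck].
  by rewrite (_ : k%:Z == _) ?mulr1 //; apply/eqP; lia.
rewrite (_ : (k%:Z == _) = false) ?mulr0 //; apply/eqP => ckx.
by move/eqP: ck; apply; apply/val_inj; rewrite /=; lia.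
Qed.

Definition toeplitz B N : 'M[R]_(B, N) := \matrix_(a, j) ext e (a%:Z - j%:Z).

Definition sgodd_mx B : 'M[R]_B := \matrix_(c, d) sgodd (d%:Z - c%:Z).

(** The bound keeps the support of every column inside the B rows, so nothing is cut off and the
    result depends on j - i alone. *)
Lemma toeplitz_sgodd B N (i j : 'I_N) : (N + n <= B)%N ->
  ((toeplitz B N)^T *m sgodd_mx B *m toeplitz B N) i j = sgcorr (j%:Z - i%:Z).
Proof.
move=> NB; rewrite mxE.
under eq_bigr => d _.
  rewrite mxE; under eq_bigr => c _ do rewrite !mxE mulrC.
  rewrite (sum_ext (fun c => sgodd (d%:Z - c%:Z))); last by have := ltn_ord i; lia.
  rewrite mxE; over.
rewrite (sum_ext (fun d => \sum_(k < n.+1) sgodd (d%:Z - (k + i)%:Z) * e k)); last first.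
  by have := ltn_ord j; lia.
rewrite /sgcorr exchange_big; apply: eq_bigr => l _; rewrite big_distrl.
apply: eq_bigr => k _ /=; rewrite -mulrA mulrC; congr (_ * sgodd _); lia.
Qed.

(** A row of powers reproduces itself under a Toeplitz matrix, up to the value of the generating
    function of [e] at [sigma s]. *)
Lemma power_toeplitz t (sigma : 'I_t -> R) B N (s : 'I_t) (j : 'I_N) : (N + n <= B)%N ->
  ((\matrix_(s < t, c < B) sigma s ^+ c) *m toeplitz B N) s j =
  (\sum_(k < n.+1) sigma s ^+ k * e k) * sigma s ^+ j.
Proof.
move=> NB; rewrite mxE; under eq_bigr => c _ do rewrite !mxE.
rewrite (sum_ext (fun c => sigma s ^+ c)); last by have := ltn_ord j; lia.
by rewrite big_distrl; apply: eq_bigr => k _; rewrite exprD mulrAC.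
Qed.

End FiniteSupport.
End Toeplitz.
(** * Sums over sequences of alternating parity *)

Section Alternating.
Variable R : comNzRingType.
Hypothesis R_torsion_free : forall k (x : R), x *+ k.+1 = 0 -> x = 0.

Definition alternating (eps : bool) (N B : nat) (q : 'I_N -> 'I_B) : bool :=
  [forall i : 'I_N, odd (q i) == odd i (+) eps].

Lemma alternatingP eps N B (q : 'I_N -> 'I_B) :
  reflect (forall i : 'I_N, odd (q i) = odd i (+) eps) (alternating eps q).
Proof. exact: 'forall_eqP. Qed.

(** If neighbours always differed in parity, the parity of the first entry would determine all the
    others. *)
Lemma nonalternating N B (q : 'I_N -> 'I_B) : (0 < N)%N ->
  (forall eps, ~~ alternating eps q) ->
  exists i j : 'I_N, j = i.+1 :> nat /\ odd (q i) = odd (q j).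
Proof.
move=> N0 h; apply: contrapT => no; case/negP: (h (odd (q (Ordinal N0)))).
apply/alternatingP => -[i iN] /=; elim: i iN => [|i IH] iN.
  by congr (odd (q _)); apply/val_inj.
have iN' : (i < N)%N by apply: leq_trans iN.
have ne : odd (q (Ordinal iN')) <> odd (q (Ordinal iN)).
  by move=> eq; apply: no; exists (Ordinal iN'), (Ordinal iN).
move: ne; rewrite IH /=.
by case: (odd i); case: (odd (q (Ordinal N0))); case: (odd (q _)).
Qed.

Lemma strict_subr_gt0 N B (q : 'I_N -> 'I_B) (i j : 'I_N) :
  strict q -> (0 < (q j)%:Z - (q i)%:Z)%R = (0 < j%:Z - i%:Z)%R.
Proof. by move=> /strict_mono h; rewrite !subr_gt0 !ltz_nat h. Qed.

Lemma sgodd_strict N B (q : 'I_N -> 'I_B) (i j : 'I_N) : strict q ->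
  sgodd R ((q j)%:Z - (q i)%:Z) =
  if odd (q i) != odd (q j) then (if (i < j)%N then 1 else -1) else 0.
Proof.
move=> h; rewrite /sgodd strict_subr_gt0 // subr_gt0 ltz_nat.
have -> // : odd `|(q j)%:Z - (q i)%:Z| = (odd (q i) != odd (q j)).
lia.
Qed.

Section Weight.
Variables (m t B : nat) (sigma : 'I_t -> R).
Hypothesis sigma2 : forall s, sigma s * sigma s = 1.
Local Notation N := (m + (m + t))%N.

Lemma sigma_odd s k : sigma s ^+ k = sigma s ^+ odd k.
Proof.
rewrite -[in LHS](odd_double_half k) exprD -mul2n exprM.
by rewrite [sigma s ^+ 2]sigma2 expr1n mulr1.
Qed.

Definition powers n : 'M[R]_(t, n) := \matrix_(s, c) sigma s ^+ c.

Definition alt_weight : R := pairsum (sgodd_mx R N) (powers N) 1%:M.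

(** [sgodd] sees only order and parity, so every alternating [q] gives the matrix of the initial
    segment; the shift [eps] multiplies each border row by its sigma. *)
Lemma pairsum_alternating (q : 'I_N -> 'I_B) eps : strict q -> alternating eps q ->
  pairsum (mxsub q q (sgodd_mx R B)) (colsub q (powers B)) 1%:M =
  (\prod_s sigma s) ^+ eps * alt_weight.
Proof.
move=> sq /alternatingP aq.
have -> : mxsub q q (sgodd_mx R B) = sgodd_mx R N.
  apply/matrixP => i j; rewrite !mxE sgodd_strict // !aq.
  by rewrite (inj_eq (can_inj (addbK eps))) [RHS](@sgodd_strict N N id) //; exact/strictP.
have -> : colsub q (powers B) = diag_mx (\row_s sigma s ^+ eps) *m powers N.
  apply/matrixP => s i; rewrite mul_diag_mx !mxE sigma_odd aq -exprD [RHS]sigma_odd oddD oddb.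
  by rewrite addbC.
rewrite pairsum_mulZ det_diag -prodrXl; congr (_ * _).
by apply: eq_bigr => s _; rewrite mxE.
Qed.

(** Two neighbours of equal parity have the same entries against every other index, entry 0 against
    each other and equal border columns. Exchanging them therefore changes nothing but the sign. *)
Lemma pairsum_nonalternating (q : 'I_N -> 'I_B) : (0 < N)%N -> strict q ->
  (forall eps, ~~ alternating eps q) ->
  pairsum (mxsub q q (sgodd_mx R B)) (colsub q (powers B)) 1%:M = 0.
Proof.
move=> N0 sq /(nonalternating N0)[x [y [yx oxy]]].
have xy : x != y by apply/eqP => xy; move: yx; rewrite xy; lia.
have odd_tperm k : odd (q (tperm x y k)) = odd (q k).
  by case: tpermP => [->|->|].
set P := pairsum _ _ _; apply: (@R_torsion_free 1); rewrite mulr2n.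
suff {1}-> : P = - P by rewrite addNr.
apply: (pairsum_tperm xy) => [i j|i j]; rewrite !mxE; last first.
  by rewrite sigma_odd odd_tperm -sigma_odd.
rewrite !sgodd_strict // !odd_tperm; case: ifP => // oij; congr (if _ then _ else _).
have ne (a b : 'I_N) : a != b -> (a : nat) <> b by move/eqP => h /val_inj.
case: (tpermP x y i) oij => [->|->|/eqP/ne ix /eqP/ne iy];
  case: (tpermP x y j) => [->|->|/eqP/ne jx /eqP/ne jy];
  rewrite ?oxy ?eqxx ?ltnn // => _; lia.
Qed.

End Weight.

(** * The reflected basis and the determinant formula *)

Section Master.
Variables (m t B : nat) (sgn : R) (sigma : 'I_t -> R).
Hypothesis sigma2 : forall s, sigma s * sigma s = 1.
Hypothesis sgn2 : sgn * sgn = 1.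
Hypothesis sigma_sgn : forall s, sigma s ^+ t = - sgn.
Local Notation N := (m + (m + t))%N.

Definition pair_coef (tau : R) (p k : nat) : R := (k == p.+1)%:R + tau * (k == p)%:R.

(* The coefficients of z^(m+t-1) (z + tau) (z^i + sgn z^(-t-i)). *)
Definition refl_coef (tau : R) (i k : nat) : R :=
  pair_coef tau (m + t + i).-1 k + sgn * pair_coef tau (m - i).-1 k.

(** The last t columns are unit vectors that complete the reflected ones to a square matrix. *)
Definition refl_mx : 'M[R]_N :=
  row_mx (\matrix_(k, i) refl_coef 1 i k)
    (row_mx (\matrix_(k, i) refl_coef (-1) i k) (\matrix_(k, x) (k == x :> nat)%:R)).

Lemma sum_pair_coef (F : nat -> R) tau p : (p.+1 < N)%N ->
  \sum_(k < N) F k * pair_coef tau p k = F p.+1 + tau * F p.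
Proof.
move=> pN; rewrite /pair_coef; under eq_bigr do rewrite mulrDr mulrCA.
by rewrite big_split /= -big_distrr /= !sum_delta // ltnW.
Qed.

Lemma sum_refl_coef (F : nat -> R) tau i : (i < m)%N ->
  \sum_(k < N) F k * refl_coef tau i k =
  F (m + t + i)%N + tau * F (m + t + i).-1 +
  sgn * (F (m - i)%N + tau * F (m - i).-1).
Proof.
move=> im; rewrite /refl_coef; under eq_bigr do rewrite mulrDr mulrCA.
rewrite big_split /= -big_distrr /= !sum_pair_coef; try lia.
by rewrite !prednK //; lia.
Qed.

Section Fixed.
Variables (n : nat) (e : nat -> R).
Hypothesis e_fin : forall k, (n < k)%N -> e k = 0.
Hypothesis NB : (N + n <= B)%N.

Definition gram : 'M[R]_N :=
  refl_mx^T *m ((toeplitz e B N)^T *m sgodd_mx R B *m toeplitz e B N) *m refl_mx.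

Lemma gramE (u v : nat -> R) (i j : 'I_N) :
  (forall k : 'I_N, refl_mx k i = u k) -> (forall k : 'I_N, refl_mx k j = v k) ->
  gram i j = \sum_(l < N) (\sum_(k < N) sgcorr n e (l%:Z - k%:Z) * u k) * v l.
Proof.
move=> ui vj; rewrite /gram mxE; apply: eq_bigr => l _; rewrite vj mxE; congr (_ * _).
by apply: eq_bigr => k _; rewrite (toeplitz_sgodd e_fin) // mxE ui mulrC.
Qed.

(** [F] is the symbol after absorbing the factors z + tau and z + tau'. Each vector has two
    reflected terms, and sgn^2 = 1 arranges the four products into two symmetric pairs. *)
Lemma gram_refl (tau tau' : R) (i j : 'I_m) (i' j' : 'I_N) :
  (forall k : 'I_N, refl_mx k i' = refl_coef tau i k) ->
  (forall k : 'I_N, refl_mx k j' = refl_coef tau' j k) ->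
  let q := sgcorr n e in
  let F z := (1 + tau * tau') * q z + tau * q (z + 1) + tau' * q (z - 1) in
  let a := j%:Z - i%:Z in let b := i%:Z + j%:Z + t%:Z in
  gram i' j' = F a + F (- a) + sgn * (F b + F (- b)).
Proof.
move=> ui vj q F a b; rewrite (gramE ui vj).
have im := ltn_ord i; have jm := ltn_ord j.
pose f (l : nat) := sgcorr n e (l%:Z - (m + t + i)%N%:Z) + tau * sgcorr n e (l%:Z - (m + t + i).-1%:Z) +
  sgn * (sgcorr n e (l%:Z - (m - i)%N%:Z) + tau * sgcorr n e (l%:Z - (m - i).-1%:Z)).
transitivity (\sum_(l < N) f l * refl_coef tau' j l).
  by apply: eq_bigr => l _; rewrite (sum_refl_coef (fun k => sgcorr n e (l%:Z - k%:Z))).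
rewrite sum_refl_coef // /f {f} /F -/q.
have -> : (m + t + j)%N%:Z - (m + t + i)%N%:Z = a by rewrite /a; lia.
have -> : (m + t + j)%N%:Z - (m + t + i).-1%:Z = a + 1 by rewrite /a; lia.
have -> : (m + t + j).-1%:Z - (m + t + i)%N%:Z = a - 1 by rewrite /a; lia.
have -> : (m + t + j).-1%:Z - (m + t + i).-1%:Z = a by rewrite /a; lia.
have -> : (m - j)%N%:Z - (m - i)%N%:Z = - a by rewrite /a; lia.
have -> : (m - j)%N%:Z - (m - i).-1%:Z = - a + 1 by rewrite /a; lia.
have -> : (m - j).-1%:Z - (m - i)%N%:Z = - a - 1 by rewrite /a; lia.
have -> : (m - j).-1%:Z - (m - i).-1%:Z = - a by rewrite /a; lia.
have -> : (m + t + j)%N%:Z - (m - i)%N%:Z = b by rewrite /b; lia.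
have -> : (m + t + j)%N%:Z - (m - i).-1%:Z = b + 1 by rewrite /b; lia.
have -> : (m + t + j).-1%:Z - (m - i)%N%:Z = b - 1 by rewrite /b; lia.
have -> : (m + t + j).-1%:Z - (m - i).-1%:Z = b by rewrite /b; lia.
have -> : (m - j)%N%:Z - (m + t + i)%N%:Z = - b by rewrite /b; lia.
have -> : (m - j)%N%:Z - (m + t + i).-1%:Z = - b + 1 by rewrite /b; lia.
have -> : (m - j).-1%:Z - (m + t + i)%N%:Z = - b - 1 by rewrite /b; lia.
have -> : (m - j).-1%:Z - (m + t + i).-1%:Z = - b by rewrite /b; lia.
move: (q a) (q (a + 1)) (q (a - 1)) (q (- a)) (q (- a + 1)) (q (- a - 1)).
move: (q b) (q (b + 1)) (q (b - 1)) (q (- b)) (q (- b + 1)) (q (- b - 1)).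
move=> b1 b2 b3 b4 b5 b6 a1 a2 a3 a4 a5 a6.
ring: sgn2.
Qed.

(** For equal tau the symbol [F] is odd, so both symmetric pairs cancel. *)
Lemma gram_refl_eq tau (i j : 'I_m) (i' j' : 'I_N) :
  (forall k : 'I_N, refl_mx k i' = refl_coef tau i k) ->
  (forall k : 'I_N, refl_mx k j' = refl_coef tau j k) -> gram i' j' = 0.
Proof.
move=> ui vj; rewrite (gram_refl ui vj) /=.
have flip (z : int) : (1 + tau * tau) * sgcorr n e (- z) + tau * sgcorr n e (- z + 1) +
    tau * sgcorr n e (- z - 1) =
    - ((1 + tau * tau) * sgcorr n e z + tau * sgcorr n e (z + 1) + tau * sgcorr n e (z - 1)).
  have -> : - z + 1 = - (z - 1) by lia.
  have -> : - z - 1 = - (z + 1) by lia.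
  rewrite !sgcorrN !mulrN -!opprD; congr (- _); exact: addrAC.
rewrite (flip (j%:Z - i%:Z)) (flip (i%:Z + j%:Z + t%:Z)).
move: (_ * _ + _ * _ + _ * _) (_ * _ + _ * _ + _ * _) => x y.
by rewrite !subrr mulr0 addr0.
Qed.

(** For opposite tau the symbol is the central difference of Q, that is twice [corr]; evenness of
    [corr] doubles it again, whence the 4. *)
Lemma gram_refl_opp (i j : 'I_m) (i' j' : 'I_N) :
  (forall k : 'I_N, refl_mx k i' = refl_coef 1 i k) ->
  (forall k : 'I_N, refl_mx k j' = refl_coef (-1) j k) ->
  gram i' j' = (corr n e (i%:Z - j%:Z) + sgn * corr n e (i%:Z + j%:Z + t%:Z)) *+ 4.
Proof.
move=> ui vj; rewrite (gram_refl ui vj) /=.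
have simpl (z : int) : (1 + 1 * -1) * sgcorr n e z + 1 * sgcorr n e (z + 1) +
    -1 * sgcorr n e (z - 1) = corr n e z *+ 2.
  by rewrite mul1r subrr mul0r add0r mul1r mulN1r (sgcorr_step e_fin).
rewrite !simpl !(corrN e_fin _ R_torsion_free) -[j%:Z - i%:Z]opprB (corrN e_fin _ R_torsion_free).
by move: (corr _ _ _) (corr _ _ _) => x y; ring.
Qed.

Lemma gramN (i j : 'I_N) : gram j i = - gram i j.
Proof.
have tQ : ((toeplitz e B N)^T *m sgodd_mx R B *m toeplitz e B N)^T =
    - ((toeplitz e B N)^T *m sgodd_mx R B *m toeplitz e B N).
  apply/matrixP => k l; rewrite [LHS]mxE [RHS]mxE !(toeplitz_sgodd e_fin) // -sgcorrN.
  by congr sgcorr; lia.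
suff /matrixP/(_ i j) : gram^T = - gram by rewrite [LHS]mxE [RHS]mxE.
by rewrite /gram trmx_mul [X in _ *m X]trmx_mul trmxK tQ mulNmx mulmxN mulmxA.
Qed.

Definition eval_at (x : R) : R := \sum_(k < n.+1) x ^+ k * e k.

(** At z = sigma the factor z^i + sgn z^(-t-i) equals sigma^i (1 + sgn sigma^t) = 0, so the border
    meets only the completing columns. *)
Lemma powers_refl_mx :
  powers sigma B *m toeplitz e B N *m refl_mx =
  row_mx 0 (row_mx 0 (diag_mx (\row_s eval_at (sigma s)) *m powers sigma t)).
Proof.
have PE s (j : 'I_N) : (powers sigma B *m toeplitz e B N) s j = eval_at (sigma s) * sigma s ^+ j.
  by rewrite /powers (power_toeplitz e_fin).
have killed s tau (i : 'I_m) :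
    \sum_(k < N) eval_at (sigma s) * sigma s ^+ k * refl_coef tau i k = 0.
  rewrite (sum_refl_coef (fun k => eval_at (sigma s) * sigma s ^+ k)) //.
  have im := ltn_ord i.
  (* This form exposes the common factor sigma^(m-i-1) together with sigma^t = -sgn and sigma^(2i) =
     1. *)
  have -> : (m + t + i)%N = (t + i.*2 + (m - i).-1).+1 by lia.
  have -> : (m - i)%N = (m - i).-1.+1 by lia.
  have even1 : sigma s ^+ i.*2 = 1 by rewrite sigma_odd // odd_double.
  rewrite /= !exprS !exprD sigma_sgn even1.
  by move: (sigma s ^+ _) => x; ring.
apply/matrixP => s j; rewrite mxE; under eq_bigr => k _ do rewrite PE.
case: (split_ordP j) => {}j ->; [|case: (split_ordP j) => {}j ->].
- rewrite row_mxEl mxE -[RHS](killed s 1 j); apply: eq_bigr => k _.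
  by rewrite /refl_mx row_mxEl mxE.
- rewrite row_mxEr row_mxEl mxE -[RHS](killed s (-1) j); apply: eq_bigr => k _.
  by rewrite /refl_mx row_mxEr row_mxEl mxE.
rewrite !row_mxEr mul_diag_mx !mxE.
rewrite -(@sum_delta _ (fun k => eval_at (sigma s) * sigma s ^+ k) N j).
  by apply: eq_bigr => k _; rewrite /refl_mx !row_mxEr mxE.
by rewrite addnA ltn_addl.
Qed.

Definition alt_sum : R :=
  \sum_(eps : bool) \sum_(q : {ffun 'I_N -> 'I_B} | strict q && alternating eps q)
    (\prod_s sigma s) ^+ eps * \det (rowsub q (toeplitz e B N)).

Definition corr_det : R :=
  \det (\matrix_(i < m, j < m) (corr n e (i%:Z - j%:Z) + sgn * corr n e (i%:Z + j%:Z + t%:Z))).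

(* The factors [\det refl_mx], [alt_weight] and [pairsum symplectic] do not depend on [e]. *)
Lemma alt_sum_raw : (0 < N)%N ->
  \det refl_mx * (alt_weight m sigma * alt_sum) =
  4 ^+ m * \det (powers sigma t) * pairsum (symplectic R m t) (last_rows R m t) 1%:M *
  ((\prod_s eval_at (sigma s)) * corr_det).
Proof.
move=> N0.
have -> : alt_weight m sigma * alt_sum =
    pairsum (sgodd_mx R B) (powers sigma B *m toeplitz e B N) (toeplitz e B N).
  rewrite pairsum_strict /alt_sum (exchange_big_dep (fun q : {ffun 'I_N -> 'I_B} => strict q)) /=;
    last by move=> eps q _ /andP[].
  rewrite big_distrr; apply: eq_bigr => q sq /=.
  under eq_bigl do rewrite sq /=.
  (* [eps] is the parity of the first entry, so at most one class contains [q]. *)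
  have [[eps aq]|/forallNP none] := pselect (exists eps, alternating eps q).
    rewrite (pairsum_alternating sigma2 sq aq) (big_pred1 eps) => [|eps'].
      by rewrite mulrCA mulrA.
    apply/idP/eqP => [aq'|-> //].
    have := alternatingP _ _ aq' (Ordinal N0); rewrite (alternatingP _ _ aq (Ordinal N0)).
    by case: (eps) (eps') => [] [].
  have none' eps : ~~ alternating eps q by apply/negP/none.
  rewrite pairsum_nonalternating // mul0r big_pred0 ?mulr0 // => eps.
  exact/negbTE.
rewrite -pairsum_mulr powers_refl_mx.
rewrite -[toeplitz e B N *m refl_mx]mulmx1 pairsum_mull.
have -> : (toeplitz e B N *m refl_mx)^T *m sgodd_mx R B *m (toeplitz e B N *m refl_mx) = gram.
  by rewrite /gram trmx_mul !mulmxA.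
pose G : 'M[R]_m := 4 *: \matrix_(i < m, j < m)
  (corr n e (i%:Z - j%:Z) + sgn * corr n e (i%:Z + j%:Z + t%:Z)).
have cl i (k : 'I_N) : refl_mx k (lshift _ i) = refl_coef 1 i k by rewrite row_mxEl mxE.
have cr i (k : 'I_N) : refl_mx k (rshift _ (lshift _ i)) = refl_coef (-1) i k.
  by rewrite /refl_mx row_mxEr row_mxEl mxE.
have GE i j : gram (lshift _ i) (rshift _ (lshift _ j)) = G i j.
  by rewrite (gram_refl_opp (cl i) (cr j)) !mxE mulr_natl.
rewrite (@pairsum_offdiag _ _ _ _ _ G) => [|i j|i j|i j|i j].
- rewrite detZ det_mulmx det_diag /corr_det.
  under eq_bigr do rewrite mxE.
  by move: (\det _) (\det _) (\prod_i _) (pairsum _ _ _) (_ ^+ m) => x1 x2 x3 x4 x5; ring.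
- exact: gram_refl_eq (cl i) (cl j).
- exact: gram_refl_eq (cr i) (cr j).
- exact: GE.
- by rewrite gramN GE.
Qed.

End Fixed.

(** * Normalization at e = (1, 0, 0, ...) *)

Section Normalization.
Let e0 (k : nat) : R := (k == 0%N)%:R.

Lemma ext_unit z : ext e0 z = (z == 0)%:R.
Proof. by case: z. Qed.

Lemma corr_unit n z : corr n e0 z = (z == 0)%:R.
Proof.
rewrite /corr big_ord_recl mul1r big1 ?addr0; last by move=> k _; rewrite mul0r.
by rewrite add0r ext_unit.
Qed.

Lemma eval_at_unit n x : eval_at n e0 x = 1.
Proof.
rewrite /eval_at big_ord_recl mulr1 big1 ?addr0 ?expr0 // => k _.
by rewrite /e0 /= mulr0.
Qed.

(** A strict self-map of ['I_M] factors both as the identity after the permutation it defines and as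
    itself after the trivial permutation; uniqueness of the rank permutation equates the two. *)
Lemma strict_lt_id (M C : nat) (q : 'I_M -> 'I_C) : strict q -> (forall i, (q i < M)%N) ->
  forall i, q i = i :> nat.
Proof.
move=> sq qM; pose g : {ffun 'I_M -> 'I_M} := [ffun i => Ordinal (qM i)].
have sg : strict g by apply/strictP => i j ij; rewrite !ffunE /= strict_mono.
pose s := perm (strict_inj sg).
have := rank_perm_comp 1%g sg.
have := rank_perm_comp (q := [ffun i => i]) s; rewrite /strict.
have -> : [ffun i => [ffun i0 => i0] (s i)] = [ffun i => g ((1%g : 'S_M) i)].
  by apply/ffunP => i; rewrite !ffunE !permE ffunE.
move=> -> => [s1 i|]; last by apply/strictP => i j; rewrite !ffunE.
have : s i = i by rewrite s1 perm1.
by rewrite permE ffunE => /(congr1 val).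
Qed.

(** The Toeplitz matrix of [e0] is an identity matrix above zero rows, so only the rows 0, ..., N-1
    give a nonzero minor. *)
Lemma alt_sum_unit : (0 < N)%N -> (N <= B)%N -> alt_sum e0 = 1.
Proof.
move=> N0 NB; pose q0 : {ffun 'I_N -> 'I_B} := [ffun i => widen_ord NB i].
have vanish (q : {ffun 'I_N -> 'I_B}) : strict q -> q != q0 -> \det (rowsub q (toeplitz e0 B N)) = 0.
  move=> sq qq0; have [/forallP lt|/forallPn[i]] := boolP [forall i, (q i < N)%N].
    case/eqP: qq0; apply/ffunP => i; apply/val_inj; rewrite ffunE /=.
    exact: strict_lt_id.
  rewrite -leqNgt => Ni; rewrite (expand_det_row _ i) big1 // => j _.
  rewrite !mxE ext_unit (_ : (_ == _) = false) ?mul0r //; apply/eqP.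
  by have := ltn_ord j; lia.
have alt0 : alternating false q0 by apply/alternatingP => i; rewrite ffunE addbF.
have st0 : strict q0 by apply/strictP => i j; rewrite !ffunE.
rewrite /alt_sum (bigD1 false) //= [X in _ + X]big1 ?addr0 => [|eps eps1].
  rewrite (bigD1 q0) ?st0 //= expr0 mul1r big1 ?addr0 => [|q /andP[/andP[sq _] qq0]].
    rewrite (_ : rowsub _ _ = 1%:M) ?det1 //; apply/matrixP => i j.
    by rewrite !mxE ffunE ext_unit subr_eq0 eqz_nat.
  by rewrite vanish ?mulr0.
apply: big1 => q /andP[sq aq]; rewrite vanish ?mulr0 //.
apply: contraNneq eps1 => qq0; rewrite qq0 in aq.
have := alternatingP _ _ aq (Ordinal N0); rewrite (alternatingP _ _ alt0 (Ordinal N0)).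
by case: eps {aq}.
Qed.

Definition unit_det : R :=
  \det (\matrix_(i < m, j < m) ((i == j)%:R + sgn * (i + j + t == 0)%N%:R)).

(** [alt_sum_raw] at [e0] expresses the unknown factor of the left side through [unit_det].
    Substituting this for general [e] leaves one common constant, whose factors are all regular. *)
Theorem alternating_sum n e : (0 < N)%N -> (N + n <= B)%N ->
  (forall k, (n < k)%N -> e k = 0) ->
  (forall x, \det (powers sigma t) * x = 0 -> x = 0) ->
  unit_det * alt_sum e = (\prod_s eval_at n e (sigma s)) * corr_det n e.
Proof.
move=> N0 NB e_fin reg.
have raw := alt_sum_raw e_fin NB N0.
have e0_fin k : (n < k)%N -> e0 k = 0 by case: k.
have := alt_sum_raw e0_fin NB N0.
rewrite alt_sum_unit //; last exact: leq_trans (leq_addr _ _) NB.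
rewrite mulr1 big1 ?mul1r => [raw0|s _]; last exact: eval_at_unit.
have ud : corr_det n e0 = unit_det.
  by congr (\det _); apply/matrixP => i j; rewrite !mxE !corr_unit subr_eq0 eqz_nat -!PoszD eqz_nat.
move: raw raw0; rewrite ud mulrA.
have [k ->] := pairsum_symplectic R m t; set c := _ * k.+1%:R => raw raw0.
have creg x : c * x = 0 -> x = 0.
  rewrite /c -!mulrA => h; apply: (@R_torsion_free k); rewrite -mulr_natl; apply: reg.
  apply: (@R_torsion_free (4 ^ m)%N.-1); rewrite prednK ?expn_gt0 //.
  by rewrite -[LHS]mulr_natl natrX.
apply/eqP; rewrite -subr_eq0; apply/eqP/creg; rewrite mulrBr -raw mulrA -raw0.
by rewrite subrr.
Qed.

End Normalization.
End Master.
End Alternating.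
(** * Adjoining the variable u *)

Section Tridiagonal.
Variable R : comNzRingType.

Lemma skip_nat n (m : 'I_n.+1) (i : 'I_n) : lift m i = (if (i < m)%N then i : nat else i.+1) :> nat.
Proof. by rewrite /= /bump; case: ltnP => //=. Qed.

(** The n by n+1 tridiagonal matrix gets a first unit row and becomes lower triangular; the rows [r]
    get a first column from its kernel. The determinant of the product is then computed in two ways,
    and expansion along the new column deletes one row at a time. *)
Lemma tridiagonal_det n (u d0 d1 : R) (tau : nat -> R) (r : nat -> 'rV[R]_n) :
  d0 * tau 0%N = d1 * tau 1%N ->
  (forall m, (1 + u ^+ 2) * tau m.+1 = tau m.+2 + u ^+ 2 * tau m) ->
  u ^+ n * tau 0%N * \det (\matrix_(i < n)
     (if i == 0%N :> nat then d0 *: r 0%N + (d1 * u) *: r 1%N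
      else (1 + u ^+ 2) *: r i + u *: (r i.-1 + r i.+1))) =
  (if n is 0 then 1 else d1) * u ^+ n * \sum_(m < n.+1) (u ^+ (n - m) * tau m) *
    \det (\matrix_(i < n) r (if (i < m)%N then i : nat else i.+1)).
Proof.
move=> tau0 tauS.
set g := \matrix_(i < n) _.
(* y spans the kernel of the tridiagonal matrix, so that L *m M is block triangular. *)
pose y m := (-1) ^+ m * (u ^+ (n - m) * tau m).
pose M : 'M[R]_(1 + n) := row_mx (\col_(m < n.+1) y m) (\matrix_(m < n.+1) r m).
pose b (i k : nat) : R := if i == 0%N then d0 * (k == 0%N)%:R + d1 * u * (k == 1%N)%:R
  else (1 + u ^+ 2) * (k == i)%:R + u * ((k == i.-1)%:R + (k == i.+1)%:R).
have sum_b (i : 'I_n) (F : nat -> R) : \sum_(k < n.+1) F k * b i k =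
    if i == 0%N :> nat then d0 * F 0%N + d1 * u * F 1%N
    else (1 + u ^+ 2) * F i + u * (F i.-1 + F i.+1).
  have ni := ltn_ord i; rewrite /b; case: ifP => i0.
    under eq_bigr do rewrite mulrDr mulrCA [F _ * (d1 * u * _)]mulrCA.
    by rewrite big_split /= -!big_distrr /= !sum_delta //; lia.
  under eq_bigr do rewrite mulrDr mulrCA [F _ * (u * _)]mulrCA mulrDr.
  by rewrite big_split /= -!big_distrr big_split /= !sum_delta //; lia.
pose L : 'M[R]_(1 + n) := \matrix_(x < n.+1, k < n.+1)
  (if x == 0%N :> nat then (k == 0%N :> nat)%:R else b x.-1 k).
have detM : \det M = \sum_(m < n.+1) (u ^+ (n - m) * tau m) *
    \det (\matrix_(i < n) r (if (i < m)%N then i : nat else i.+1)).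
  rewrite (expand_det_col M ord0); apply: eq_bigr => m _.
  have e0 : ord0 = lshift n (ord0 : 'I_1) by apply/val_inj.
  rewrite {1}/M {1}e0 row_mxEl mxE /cofactor /y addn0 mulrACA -expr2 sqrr_sign mul1r.
  congr (_ * \det _); apply/matrixP => i j; rewrite [LHS]mxE [LHS]mxE /M.
  have -> : lift ord0 j = rshift 1 j by apply/val_inj.
  by rewrite row_mxEr !mxE skip_nat.
have detL : \det L = (if n is 0 then 1 else d1) * u ^+ n.
  rewrite det_trig; last first.
    apply/is_trig_mxP; change (forall i j : 'I_n.+1, (i < j)%N -> (L : 'M_n.+1) i j = 0).
    move=> i j ij; rewrite !mxE /b.
    have neq (k : nat) : (k < j)%N -> (j == k :> nat) = false by move=> kj; apply/eqP; lia.
    case: (i =P 0%N :> nat) => i0; first by rewrite neq //; lia.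
    have {}i0 : (0 < @nat_of_ord n.+1 i)%N by rewrite lt0n; apply/eqP.
    case: ifP => i1; rewrite !neq ?(mulr0, addr0) //; lia.
  transitivity (\prod_(x < n.+1) (if x == 0%N :> nat then 1 else b x.-1 x)).
    by apply: eq_bigr => x _; rewrite mxE; case: ifP => [/eqP->|].
  rewrite big_ord_recl mul1r.
  transitivity (\prod_(i < n) (if i == 0%N :> nat then d1 * u else u)).
    apply: eq_bigr => i _; rewrite /b /= /bump /= ?add0n ?add1n ?eqSS ?eqxx.
    have neq (k : nat) : (k.+1 == k) = false by apply/eqP; lia.
    have neq' (k : nat) : (k.+1 == k.-1) = false by apply/eqP; lia.
    by case: ifP => i0; rewrite ?i0 ?neq ?neq' !(mulr0, add0r, mulr1).
  case: (n) => [|n']; first by rewrite big_ord0 mulr1.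
  by rewrite big_ord_recl /= prodr_const card_ord exprS mulrA.
have LM : L *m M = block_mx (y 0%N)%:M (r 0%N) 0 g.
  have yS (i : 'I_n) : i != 0%N :> nat ->
      (1 + u ^+ 2) * y i + u * (y i.-1 + y i.+1) = 0.
    rewrite /y; have := ltn_ord i; case: (nat_of_ord i) => // k kn _ /=.
    have -> : (n - k = (n - k.+2).+2)%N by lia.
    have -> : (n - k.+1 = (n - k.+2).+1)%N by lia.
    have -> : tau k.+2 = (1 + u ^+ 2) * tau k.+1 - u ^+ 2 * tau k by rewrite tauS addrK.
    rewrite !exprS !expr0; move: (_ ^+ k) (_ ^+ (_ - _)) (tau k) (tau k.+1) => x1 x2 t0 t1.
    have aux : (1 + u * (u * 1)) * (-1 * x1 * (u * x2 * t1)) +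
      u * (x1 * (u * (u * x2) * t0) + -1 * (-1 * x1) *
      (x2 * ((1 + u * (u * 1)) * t1 - u * (u * 1) * t0))) = 0.
      by ring.
    exact: aux.
  have y0 : (0 < n)%N -> d0 * y 0%N + d1 * u * y 1%N = 0.
    move=> n0; rewrite /y subn0 mul1r expr1.
    have -> : u ^+ n = u * u ^+ (n - 1) by rewrite -exprS; congr (_ ^+ _); lia.
    move: (_ ^+ (n - 1)) => x.
    have -> : d0 * (u * x * tau 0%N) + d1 * u * (-1 * (x * tau 1%N)) =
      u * x * (d0 * tau 0%N - d1 * tau 1%N) by ring.
    by rewrite tau0 subrr mulr0.
  apply/matrixP => x k; rewrite mxE.
  case: (split_ordP x) => i ->; case: (split_ordP k) => j ->.
  - rewrite block_mxEul !ord1 mxE eqxx -(@sum_delta _ y n.+1 0) //.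
    by apply: eq_bigr => l _; rewrite /L /M row_mxEl !mxE mulrC.
  - rewrite block_mxEur !ord1 -(@sum_delta _ (fun l => r l 0 j) n.+1 0) //.
    by apply: eq_bigr => l _; rewrite /L /M row_mxEr !mxE mulrC.
  - rewrite block_mxEdl !ord1 mxE; transitivity (\sum_(k < n.+1) y k * b i k).
      by apply: eq_bigr => l _; rewrite /L /M row_mxEl !mxE mulrC.
    rewrite sum_b; case: eqP => i0; first by rewrite y0 //; have := ltn_ord i; lia.
    by apply: yS; apply/eqP.
  rewrite block_mxEdr !mxE; transitivity (\sum_(k < n.+1) r k 0 j * b i k).
    by apply: eq_bigr => l _; rewrite /L /M row_mxEr !mxE mulrC.
  by rewrite (sum_b i (fun l => r l 0 j)); case: ifP => i0; rewrite ?i0 !mxE.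
by rewrite -detM -detL -det_mulmx LM det_ublock det_scalar1 /y expr0 mul1r subn0.
Qed.
End Tridiagonal.
Section ExtraVariable.
Variables (R : comNzRingType) (u : R) (n : nat) (e : nat -> R).
Hypothesis e_fin : forall k, (n < k)%N -> e k = 0.

(** The generating function multiplied by 1 + uz. *)
Definition adjoin k : R := e k + u * ext e (k%:Z - 1).

Lemma ext_fin z : (n%:Z < z)%R -> ext e z = 0.
Proof. by case: z => // k; rewrite ltz_nat => /e_fin. Qed.

Lemma ext_neg (e' : nat -> R) z : (z < 0)%R -> ext e' z = 0.
Proof. by case: z. Qed.

Lemma ext_adjoin z : ext adjoin z = ext e z + u * ext e (z - 1).
Proof. by case: z => // k; rewrite !ext_neg ?mulr0 ?addr0 //; lia. Qed.

Lemma adjoin_fin k : (n.+1 < k)%N -> adjoin k = 0.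
Proof. by move=> nk; rewrite /adjoin e_fin ?ext_fin ?mulr0 ?addr0 //; lia. Qed.

Lemma sum_adjoin (G : nat -> R) :
  \sum_(k < n.+2) adjoin k * G k = \sum_(k < n.+1) e k * (G k + u * G k.+1).
Proof.
rewrite /adjoin; under eq_bigr do rewrite mulrDl.
rewrite big_split /= big_ord_recr /= e_fin // mul0r addr0.
rewrite [X in _ + X]big_ord_recl [ext e _]ext_neg // mulr0 mul0r add0r -big_split.
apply: eq_bigr => k _; rewrite [RHS]mulrDr; congr (_ + _).
have -> : (lift ord0 k)%:Z - 1 = k%:Z by rewrite /= /bump; lia.
by rewrite /= mulrCA mulrA.
Qed.

Lemma eval_at_adjoin x : eval_at n.+1 adjoin x = (1 + u * x) * eval_at n e x.
Proof.
rewrite /eval_at; under eq_bigr do rewrite mulrC.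
rewrite sum_adjoin big_distrr; apply: eq_bigr => k _ /=.
by rewrite exprS; move: (x ^+ k) (e k) => a b; ring.
Qed.

Lemma corr_adjoin z : corr n.+1 adjoin z =
  (1 + u ^+ 2) * corr n e z + u * (corr n e (z - 1) + corr n e (z + 1)).
Proof.
rewrite /corr (sum_adjoin (fun k => ext adjoin (k%:Z + z))).
rewrite -big_split !big_distrr -big_split; apply: eq_bigr => k _ /=.
rewrite !ext_adjoin.
have -> : k.+1%:Z + z = k%:Z + (z + 1) by lia.
have -> : k%:Z + (z + 1) - 1 = k%:Z + z by lia.
have -> : k%:Z + z - 1 = k%:Z + (z - 1) by lia.
by move: (ext _ _) (ext _ _) (ext _ _) (e k) => x1 x2 x3 x4; ring.
Qed.

Section RefinedDet.
Variables (m t : nat) (sgn eta : R).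

Definition corr_row (i : int) : 'rV[R]_m :=
  \row_j (corr n e (i - j%:Z) + sgn * corr n e (i + j%:Z + t%:Z)).

Definition refined_det k : R :=
  \det (\matrix_(i < m) corr_row (if (i < m - k)%N then i : nat else i.+1)%:Z).

Definition refined_sum : R :=
  \sum_(k < m.+1) (u ^+ k + eta * u ^+ (2 * m + t - k)) * refined_det k.

Lemma refined_corr_det (d0 d1 : R) :
  GRing.lreg u ->
  (1 + u ^+ 2) *: corr_row 0 + u *: (corr_row (-1) + corr_row 1) =
    d0 *: corr_row 0 + (d1 * u) *: corr_row 1 ->
  d0 * (1 + eta * u ^+ t) = d1 * (1 + eta * u ^+ t.+2) ->
  (1 + eta * u ^+ t) * corr_det m t sgn n.+1 adjoin =
  (if m is 0 then 1 else d1) * refined_sum.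
Proof.
move=> ureg row0 tau0.
pose tau i := 1 + eta * u ^+ (2 * i + t).
have tauS i : (1 + u ^+ 2) * tau i.+1 = tau i.+2 + u ^+ 2 * tau i.
  rewrite /tau (_ : 2 * i.+2 + t = (2 * i + t).+4)%N; last by lia.
  rewrite (_ : 2 * i.+1 + t = (2 * i + t).+2)%N; last by lia.
  by rewrite !exprS; move: (_ ^+ (2 * i + t)) => x; ring.
have := tridiagonal_det (fun i : nat => corr_row i%:Z) (tau := tau) tau0 tauS.
rewrite -!mulrA [_ * (u ^+ m * _)]mulrCA => /(@lregX _ _ m ureg) h.
(* Omitting row i shifts the k = m - i rows after it, hence the reversal of the sum. *)
rewrite -[1 + eta * u ^+ t]/(tau 0%N) /refined_sum (reindex_inj rev_ord_inj) /=.
transitivity (tau 0%N * \det (\matrix_(i < m)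
     (if i == 0%N :> nat then d0 *: corr_row 0 + (d1 * u) *: corr_row 1
      else (1 + u ^+ 2) *: corr_row i%:Z + u *: (corr_row i.-1%:Z + corr_row i.+1%:Z)))).
  congr (_ * \det _); apply/matrixP => i j; rewrite mxE !corr_adjoin [RHS]mxE.
  have -> : (if i == 0%N :> nat then d0 *: corr_row 0 + (d1 * u) *: corr_row 1
      else (1 + u ^+ 2) *: corr_row i%:Z + u *: (corr_row i.-1%:Z + corr_row i.+1%:Z)) =
      (1 + u ^+ 2) *: corr_row i%:Z + u *: (corr_row (i%:Z - 1) + corr_row (i%:Z + 1)).
    case: eqP => [->|i0]; first by rewrite -row0 add0r.
    by congr (_ + _ *: (corr_row _ + corr_row _)); lia.
  rewrite !mxE.
  have -> : i%:Z - 1 - j%:Z = i%:Z - j%:Z - 1 by lia.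
  have -> : i%:Z + 1 - j%:Z = i%:Z - j%:Z + 1 by lia.
  have -> : i%:Z - 1 + j%:Z + t%:Z = i%:Z + j%:Z + t%:Z - 1 by lia.
  have -> : i%:Z + 1 + j%:Z + t%:Z = i%:Z + j%:Z + t%:Z + 1 by lia.
  by do 6 (move: (corr _ _ _) => ?); ring.
rewrite h; congr (_ * _); apply: eq_bigr => k _ /=.
have km := ltn_ord k; rewrite subSS /refined_det subKn //; congr (_ * _).
rewrite /tau mulrDr mulr1 mulrCA -exprD; congr (_ + _ * _ ^+ _); lia.
Qed.

End RefinedDet.
End ExtraVariable.

(** * Expansion of determinants when one variable is adjoined *)

Section RowExpansion.
Variables (R : comNzRingType) (u : R).

Definition ext_det (e : nat -> R) N (p : 'I_N -> int) : R :=
  \det (\matrix_(i < N, j < N) ext e (p i - j%:Z)).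

Lemma ext_det_neg e N (p : 'I_N -> int) i : (p i < 0)%R -> ext_det e p = 0.
Proof.
move=> pi; rewrite /ext_det (expand_det_row _ i) big1 // => j _.
by rewrite mxE ext_neg ?mul0r //; lia.
Qed.

Lemma ext_det_big e n N (p : 'I_N -> int) i :
  (forall k, (n < k)%N -> e k = 0) -> ((N + n)%N%:Z <= p i)%R -> ext_det e p = 0.
Proof.
move=> e_fin pi; rewrite /ext_det (expand_det_row _ i) big1 // => j _.
by rewrite mxE (ext_fin e_fin) ?mul0r //; have := ltn_ord j; lia.
Qed.

Lemma ext_det_eq e N (p : 'I_N -> int) i j : i != j -> p i = p j -> ext_det e p = 0.
Proof.
by move=> ij pij; rewrite /ext_det (determinant_alternate ij) // => k; rewrite !mxE pij.
Qed.

Lemma eq_ext_det e N (p q : 'I_N -> int) : p =1 q -> ext_det e p = ext_det e q.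
Proof. by move=> pq; congr (\det _); apply/matrixP => i j; rewrite !mxE pq. Qed.

(** Each row is a sum of two rows, and [S] marks those lowered by one. The expansion serves both for
    the extra variable [u] and for the induction on the number of variables in the dual Jacobi-Trudi
    formula. *)
Lemma ext_det_expand (e e' : nat -> R) N (p : 'I_N -> int) :
  (forall z, ext e' z = ext e z + u * ext e (z - 1)) ->
  ext_det e' p =
  \sum_(S : {ffun 'I_N -> bool}) u ^+ (\sum_i S i) * ext_det e (fun i => p i - (S i)%:Z).
Proof.
move=> ee'; rewrite /ext_det /determinant.
under [RHS]eq_bigr do rewrite big_distrr /=.
rewrite exchange_big; apply: eq_bigr => s _ /=.
under eq_bigr => i _.
  rewrite mxE ee' (_ : _ + _ = \sum_(b : bool) u ^+ b * ext e (p i - b%:Z - (s i)%:Z)); last first.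
    by rewrite big_bool /= expr0 mul1r subr0 expr1 addrC addrAC.
  over.
rewrite bigA_distr_bigA big_distrr; apply: eq_bigr => S _ /=.
rewrite mulrCA big_split /= expr_sum; congr (_ * (_ * _)).
by apply: eq_bigr => i _; rewrite mxE.
Qed.

(* Only the rows that stay nonnegative and distinct contribute. *)
Lemma ext_det_sub e N B (q : 'I_N -> 'I_B) (S : 'I_N -> bool) : strict q ->
  ext_det e (fun i => (q i)%:Z - (S i)%:Z) <> 0 ->
  (forall i, (S i <= q i)%N) /\ (forall i j : 'I_N, (i < j)%N -> (q i - S i < q j - S j)%N).
Proof.
move=> sq nz; have Sq i : (S i <= q i)%N.
  by rewrite leqNgt; apply/negP => lt; apply: nz; apply: (@ext_det_neg _ _ _ i); lia.
split=> // i j ij; rewrite ltnNge; apply/negP => le.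
have := strict_mono sq i j; rewrite ij => qij.
apply: nz; apply: (@ext_det_eq _ _ _ i j); first by apply: contraTneq ij => ->; rewrite ltnn.
by have := Sq i; have := Sq j; case: (S i) le; case: (S j) => /=; lia.
Qed.

End RowExpansion.

Section AlternatingExpansion.
Variables (R : comNzRingType) (u : R) (n m t b : nat) (e : nat -> R) (sigma : 'I_t -> R).
Hypothesis e_fin : forall k, (n < k)%N -> e k = 0.
Local Notation N := (m + (m + t))%N.
Hypothesis Nb : (N + n <= b.+1)%N.

(* The rows that have to move up by one for the parity class [eps]; for [eps = false] they
   correspond to the columns of odd length. *)
Definition defect (eps : bool) (q : 'I_N -> 'I_b.+1) (i : 'I_N) : bool :=
  odd (q i) != odd i (+) eps.

(** Given [q] and [eps], parity dictates which rows were lowered to arrive at [q], so exactly one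
    alternating sequence leads there. The bound drops from [b.+2] to [b.+1] because higher rows left
    in place have zero minors. *)
Lemma alt_sum_adjoin :
  alt_sum m b.+2 sigma (adjoin u e) =
  \sum_(q : {ffun 'I_N -> 'I_b.+1} | strict q)
    (\sum_(eps : bool) (\prod_s sigma s) ^+ eps * u ^+ (\sum_i defect eps q i)) *
    ext_det e (fun i => (q i)%:Z).
Proof.
under [RHS]eq_bigr do rewrite big_distrl /=.
rewrite exchange_big; apply: eq_bigr => eps _ /=.
under [RHS]eq_bigr do rewrite -mulrA.
rewrite -!big_distrr /=; congr (_ * _).
transitivity (\sum_(q : {ffun 'I_N -> 'I_b.+2} | strict q && alternating eps q)
   \sum_(S : {ffun 'I_N -> bool}) u ^+ (\sum_i S i) * ext_det e (fun i => (q i)%:Z - (S i)%:Z)).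
  apply: eq_bigr => q _; rewrite -(ext_det_expand _ (ext_adjoin u e)).
  by congr (\det _); apply/matrixP => i j; rewrite !mxE.
pose good (q : {ffun 'I_N -> 'I_b.+2}) (S : {ffun 'I_N -> bool}) :=
  [&& [forall i, (S i <= q i)%N], [forall i, (q i - S i < b.+1)%N] &
   [forall i : 'I_N, forall j : 'I_N, (i < j)%N ==> (q i - S i < q j - S j)%N]].
rewrite pair_big_dep /= (bigID (fun x => good x.1 x.2)) /= [X in _ + X]big1 ?addr0; last first.
  move=> [q S] /= /andP[/andP[/andP[sq _] _]]; apply: contraNeq.
  move=> nz; have {}nz : ext_det e (fun i => (q i)%:Z - (S i)%:Z) <> 0.
    by move=> z; rewrite z mulr0 eqxx in nz.
  have [h1 h2] := ext_det_sub sq nz; apply/and3P; split.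
  - exact/forallP.
  - apply/forallP => i; rewrite ltnNge; apply/negP => le; apply: nz.
    by apply: (@ext_det_big _ _ n _ _ i) => //; have := h1 i; lia.
  - by apply/forallP => i; apply/forallP => j; apply/implyP; apply: h2.
(* The bijection: [hq] raises the defective rows, [hS] records them, [h'] lowers them again. *)
have [hq h1] : exists hq : {ffun 'I_N -> 'I_b.+1} -> {ffun 'I_N -> 'I_b.+2},
    forall q i, hq q i = (q i + defect eps q i)%N :> nat.
  exists (fun q : {ffun 'I_N -> 'I_b.+1} => [ffun i => inord (q i + defect eps q i)]) => q i.
  by rewrite ffunE inordK //; have := ltn_ord (q i); case: (defect _ _ _) => /=; lia.
have [hS h2] : exists hS : {ffun 'I_N -> 'I_b.+1} -> {ffun 'I_N -> bool},
    forall q i, hS q i = defect eps q i.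
  by exists (fun q : {ffun 'I_N -> 'I_b.+1} => [ffun i => defect eps q i]) => q i; rewrite ffunE.
have [h' h3] : exists h' : {ffun 'I_N -> 'I_b.+2} * {ffun 'I_N -> bool} -> {ffun 'I_N -> 'I_b.+1},
    forall (x : {ffun 'I_N -> 'I_b.+2} * {ffun 'I_N -> bool}) i,
      (x.1 i - x.2 i < b.+1)%N -> h' x i = (x.1 i - x.2 i)%N :> nat.
  exists (fun x : {ffun 'I_N -> 'I_b.+2} * {ffun 'I_N -> bool} =>
    [ffun i => inord (x.1 i - x.2 i)]) => x i lt.
  by rewrite ffunE inordK.
have h'h q : h' (hq q, hS q) = q.
  by apply/ffunP => i; apply/val_inj; rewrite /= h3 /= h1 h2 addnK.
rewrite (reindex_onto (fun q : {ffun 'I_N -> 'I_b.+1} => (hq q, hS q)) h')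
  => [|[q S] /= /andP[/andP[/andP[sq /alternatingP aq] _] /and3P[]]] /=; last first.
  move=> /forallP Sq /forallP qSb _.
  have h'E i : h' (q, S) i = (q i - S i)%N :> nat by rewrite h3 //=; exact: qSb.
  have dE i : defect eps (h' (q, S)) i = S i.
    by rewrite /defect h'E oddB // aq oddb; case: (odd i); case: (eps); case: (S i).
  congr pair; apply/ffunP => i; last by rewrite h2 dE.
  by apply/val_inj; rewrite /= h1 h'E dE subnK.
apply: eq_big => q; last first.
  move=> _; congr (_ ^+ _ * _); first by apply: eq_bigr => i _; rewrite h2.
  by apply: eq_ext_det => i; rewrite h1 h2; lia.
rewrite andbT h'h eqxx andbT; apply/andP/idP => [[_ /and3P[_ _ /forallP st]]|sq].
  apply/strictP => i j ij; have /forallP/(_ j)/implyP := st i.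
  by rewrite !h1 !h2 !addnK => /(_ ij).
have oddh i : odd (hq q i) = odd i (+) eps.
  rewrite h1 oddD oddb /defect.
  by case: (odd (q i)); case: (odd i); case: (eps).
split; [apply/andP; split|apply/and3P; split].
(* Raising could at worst make two neighbours equal, but they end with opposite parities; rows
   further apart differ by at least 2. *)
- apply/strictP => i j ij; have [ji|ji] := eqVneq (j : nat) i.+1.
    have := oddh i; have := oddh j; rewrite ji /=.
    have := strict_mono sq i j; rewrite ij !h1.
    case: (defect eps q i); case: (defect eps q j) => /=; lia.
  have iN : (i.+1 < N)%N by have := ltn_ord j; lia.
  have := strict_mono sq i (Ordinal iN); rewrite /= ltnSn.
  have iNj : (Ordinal iN < j)%N by rewrite /=; lia.
  have := strict_mono sq (Ordinal iN) j; rewrite iNj !h1.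
  by case: (defect eps q i); case: (defect eps q j) => /=; lia.
- exact/alternatingP.
- by apply/forallP => i; rewrite h1 h2 leq_addl.
- by apply/forallP => i; rewrite h1 h2 addnK.
apply/forallP => i; apply/forallP => j; apply/implyP => ij.
by rewrite !h1 !h2 !addnK strict_mono.
Qed.

End AlternatingExpansion.

(** * The cases t = 0, 1, 2 *)

Section RefinedAlternatingSum.
Variables (R : comNzRingType) (u : R) (n m B : nat) (e : nat -> R).
Hypothesis R_torsion_free : forall k (x : R), x *+ k.+1 = 0 -> x = 0.
Hypothesis u_reg : GRing.lreg u.
Hypothesis e_fin : forall k, (n < k)%N -> e k = 0.

Lemma natr_reg k (x : R) : k.+1%:R * x = 0 -> x = 0.
Proof. by rewrite mulr_natl; exact: R_torsion_free. Qed.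

(** Evenness of [corr] exchanges the two terms of an entry. Applied to the row of index -1, this
    yields the boundary coefficients of the tridiagonal matrix. *)
Lemma corr_rowN t (s : R) i : s * s = 1 ->
  corr_row n e m t s (- i) = s *: corr_row n e m t s (i - t%:Z).
Proof.
move=> s2; apply/rowP => j; rewrite !mxE mulrDr mulrA s2 mul1r addrC.
rewrite -[corr n e (- i - j%:Z)](corrN e_fin _ R_torsion_free).
rewrite -[corr n e (- i + j%:Z + t%:Z)](corrN e_fin _ R_torsion_free).
by congr (_ * corr _ _ _ + corr _ _ _); lia.
Qed.

Lemma unit_det1 t (s : R) : (0 < t)%N -> unit_det m t s = 1.
Proof.
move=> t0; rewrite /unit_det (_ : \matrix_(i, j) _ = 1%:M) ?det1 //.
apply/matrixP => i j; rewrite !mxE (_ : (_ == 0)%N = false) ?mulr0 ?addr0 //.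
by apply/eqP; lia.
Qed.

(** The reflected term doubles the corner entry i = j = 0 and nothing else. This is the origin of
    the factor 1/2 in the first identity. *)
Lemma unit_det0 : (0 < m)%N -> unit_det m 0 (1 : R) = 2.
Proof.
case: m => // m' _; rewrite /unit_det.
rewrite (_ : \matrix_(i, j) _ = diag_mx (\row_(i < m'.+1) (if i == 0%N :> nat then 2 else 1))).
  rewrite det_diag big_ord_recl mxE /= big1 ?mulr1 // => i _; by rewrite mxE.
apply/matrixP => i j; rewrite !mxE addn0 addn_eq0 mul1r.
have [->|ij] := eqVneq i j; first by rewrite andbb mulr1n; case: ifP; rewrite ?addr0.
rewrite mulr0n add0r (_ : (_ && _) = false) //; apply: contraNF ij => /andP[/eqP i0 /eqP j0].
by apply/eqP/val_inj; rewrite /= i0 j0.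
Qed.

(** For t > 0 the normalizing determinant is 1. Evaluating the enlarged generating function
    contributes the product of the 1 + u sigma, exactly the factor that [refined_corr_det] asks
    for. *)
Lemma refined_alternating_pos t (s eta d0 : R) (sigma : 'I_t -> R) :
  (0 < t)%N -> (m + (m + t) + n.+1 <= B)%N ->
  (forall i, sigma i * sigma i = 1) -> s * s = 1 -> (forall i, sigma i ^+ t = - s) ->
  (forall x, \det (powers sigma t) * x = 0 -> x = 0) ->
  \prod_i (1 + u * sigma i) = 1 + eta * u ^+ t ->
  (1 + u ^+ 2) *: corr_row n e m t s 0 + u *: (corr_row n e m t s (-1) + corr_row n e m t s 1) =
    d0 *: corr_row n e m t s 0 + u *: corr_row n e m t s 1 ->
  d0 * (1 + eta * u ^+ t) = 1 + eta * u ^+ t.+2 ->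
  alt_sum m B sigma (adjoin u e) =
  (\prod_i eval_at n e (sigma i)) * refined_sum u n e m t s eta.
Proof.
move=> t0 NB sigma2 s2 sigma_s sigma_reg prodE row0 tau0.
have N0 : (0 < m + (m + t))%N by lia.
have := alternating_sum R_torsion_free sigma2 s2 sigma_s N0 NB (adjoin_fin u e_fin) sigma_reg.
rewrite (unit_det1 _ t0) mul1r => ->.
under eq_bigr do rewrite (eval_at_adjoin _ e_fin).
have tau1 : d0 * (1 + eta * u ^+ t) = 1 * (1 + eta * u ^+ t.+2) by rewrite mul1r.
have row1 : (1 + u ^+ 2) *: corr_row n e m t s 0 +
    u *: (corr_row n e m t s (-1) + corr_row n e m t s 1) =
    d0 *: corr_row n e m t s 0 + (1 * u) *: corr_row n e m t s 1.
  by rewrite row0 mul1r.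
rewrite big_split /= prodE mulrAC (refined_corr_det e_fin u_reg row1 tau1) mulrC; congr (_ * _).
by case: (m) => [|?]; rewrite mul1r.
Qed.

Lemma refined_alternating0 (sigma : 'I_0 -> R) : (0 < m)%N -> (m + (m + 0) + n.+1 <= B)%N ->
  alt_sum m B sigma (adjoin u e) *+ 2 = refined_sum u n e m 0 1 1.
Proof.
move=> m0 NB; have no (s : 'I_0) (P : Prop) : P by case: s.
have N0 : (0 < m + (m + 0))%N by lia.
have sigma_reg x : \det (powers sigma 0) * x = 0 -> x = 0 by rewrite det_mx00 mul1r.
have := alternating_sum R_torsion_free (fun s => no s _) (mulr1 1) (fun s => no s _) N0 NB
  (adjoin_fin u e_fin) sigma_reg.
rewrite (unit_det0 m0) big_ord0 mul1r mulr_natl => ->.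
(* For t = 0 the rows -1 and 1 coincide, so d1 = 2. *)
have row1 : (1 + u ^+ 2) *: corr_row n e m 0 1 0 +
    u *: (corr_row n e m 0 1 (-1) + corr_row n e m 0 1 1) =
    (1 + u ^+ 2) *: corr_row n e m 0 1 0 + (2 * u) *: corr_row n e m 0 1 1.
  rewrite corr_rowN ?mulr1 // subr0 scale1r -mulr2n.
  by rewrite -scaler_nat scalerA [u * _]mulrC.
have tau1 : (1 + u ^+ 2) * (1 + 1 * u ^+ 0) = 2 * (1 + 1 * u ^+ 2) by rewrite expr0; ring.
have := refined_corr_det e_fin u_reg row1 tau1.
rewrite expr0 mul1r; case: (m) m0 => // m' _ /eqP; rewrite -subr_eq0 -mulrBr => /eqP.
by move/(@natr_reg 1)/eqP; rewrite subr_eq0 => /eqP.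
Qed.

(** Row -1 is -s times row 0, so d0 = 1 + u^2 - su, and (1 + u^2 - su)(1 + su) = 1 + s u^3. *)
Lemma refined_alternating1 (s : R) : s * s = 1 -> (m + (m + 1) + n.+1 <= B)%N ->
  alt_sum m B (fun _ : 'I_1 => s) (adjoin u e) = eval_at n e s * refined_sum u n e m 1 (- s) s.
Proof.
move=> s2 NB; have s2' : - s * - s = 1 by rewrite mulrNN.
have := @refined_alternating_pos 1 (- s) s (1 + u ^+ 2 - u * s) (fun=> s).
rewrite big_ord1 => ->; rewrite ?big_ord1 ?expr1 ?opprK //.
- by move=> x; rewrite det_mx11 mxE expr0 mul1r.
- by rewrite mulrC.
- rewrite corr_rowN // subrr; move: (corr_row _ _ _ _ _ _) (corr_row _ _ _ _ _ _) => x y.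
  by rewrite scalerDr scalerA mulrN scaleNr scalerBl addrA.
rewrite !exprS expr0 !mulr1; transitivity (1 + s * (u * (u * u)) + (u * u) * (1 - s * s)); first by ring.
by rewrite s2 subrr mulr0 addr0.
Qed.

(** Row -1 is its own negative, hence zero, and d0 = 1 + u^2. *)
Lemma refined_alternating2 : (m + (m + 2) + n.+1 <= B)%N ->
  alt_sum m B (fun i : 'I_2 => (-1) ^+ i) (adjoin u e) =
  eval_at n e 1 * eval_at n e (-1) * refined_sum u n e m 2 (-1) (-1).
Proof.
move=> NB; have s2 : -1 * -1 = 1 :> R by rewrite mulrNN mulr1.
have := @refined_alternating_pos 2 (-1) (-1) (1 + u ^+ 2) (fun i => (-1) ^+ i).
rewrite !big_ord_recl !big_ord0 /= expr0 expr1 !mulr1 => -> //.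
- by case=> -[|[|//]] ? /=; rewrite ?expr0 ?expr1 ?mulr1.
- by case=> -[|[|//]] ? /=; rewrite ?expr0 ?expr1 ?opprK ?sqrrN ?expr1n.
(* The Vandermonde determinant of 1 and -1 is -2. *)
- move=> x; rewrite (expand_det_row _ ord0) !big_ord_recl big_ord0 /cofactor !det_mx11 !mxE /=.
  rewrite /bump /= !(expr0, expr1) => x0; apply: (natr_reg (k := 1)); apply: oppr_inj.
  by rewrite oppr0 -[RHS]x0; ring.
- by ring.
- have : corr_row n e m 2 (-1) (-1) = - corr_row n e m 2 (-1) (-1).
    by rewrite {1}corr_rowN // scaleN1r.
  move=> rowN; have -> : corr_row n e m 2 (-1) (-1) = 0.
    apply/rowP => j; rewrite [RHS]mxE; apply: (R_torsion_free (k := 1)).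
    by rewrite mulr2n {1}rowN mxE addNr.
  by rewrite add0r.
- by rewrite !exprS expr0; ring.
Qed.
End RefinedAlternatingSum.
(** * Truncation to finitely many variables *)

Section Truncation.
Context {R : comNzRingType}.
Implicit Types (f g : series nat R) (n k : nat).

Definition low_monom n (mo : {cmonom nat}) : bool := `[< forall i, (n <= i)%N -> mo i = 0%N >].

Lemma low_monomM n a b : low_monom n (mmul a b) = low_monom n a && low_monom n b.
Proof.
apply/asboolP/andP => [h|[/asboolP ha /asboolP hb] i ni]; last by rewrite cmM ha ?hb.
by split; apply/asboolP => i /h; rewrite cmM => /eqP; rewrite addn_eq0 => /andP[/eqP ? /eqP ?].
Qed.

Lemma low_monom1 n : low_monom n mone.
Proof. by apply/asboolP => i _; rewrite cm1. Qed.

Lemma low_monomU n i : low_monom n (ucm i) = (i < n)%N.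
Proof.
apply/asboolP/idP => [h|ltin j nj]; last by rewrite ucmE; case: eqP => // ij; lia.
by rewrite ltnNge; apply/negP => /h; rewrite ucmE eqxx.
Qed.

(** The substitution x_i = 0 for i >= n. *)
Definition trunc n f : series nat R := Series (fun mo => if low_monom n mo then coef f mo else 0).

Lemma coef_truncE n f mo : coef (trunc n f) mo = if low_monom n mo then coef f mo else 0.
Proof. by []. Qed.

Lemma coef_trunc n f mo : low_monom n mo -> coef (trunc n f) mo = coef f mo.
Proof. by move=> /= ->. Qed.

Fact trunc_is_additive n : zmod_morphism (trunc n).
Proof.
move=> f g; apply: seriesP => mo; rewrite Defs.coefD Defs.coefN /=.
by case: ifP => _; rewrite ?subr0.
Qed.

Fact trunc_is_monoid n : monoid_morphism (trunc n).
Proof.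
split=> [|f g]; apply: seriesP => mo.
  rewrite coef_truncE; case: ifP => // /negP low; rewrite Defs.coef1.
  by case: eqP => // mo1; rewrite mo1 low_monom1 in low.
rewrite Defs.coefM coef_truncE; case: ifP => low.
  apply: eq_fsbigr => -[a b] /set_mem /= ab.
  by move: low; rewrite -ab low_monomM => /andP[-> ->].
rewrite fsbig1 // => -[a b] /= ab; move: low; rewrite -ab low_monomM.
by case: (low_monom n a) => /= [->|_]; rewrite ?mulr0 ?mul0r.
Qed.

Fact trunc_is_scalable n : scalable (trunc n).
Proof. by move=> c f; apply: seriesP => mo /=; case: ifP => _; rewrite ?mulr0. Qed.

HB.instance Definition _ n :=
  GRing.isZmodMorphism.Build (series nat R) (series nat R) (trunc n) (trunc_is_additive n).
HB.instance Definition _ n :=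
  GRing.isMonoidMorphism.Build (series nat R) (series nat R) (trunc n) (trunc_is_monoid n).
HB.instance Definition _ n :=
  GRing.isScalable.Build R (series nat R) (series nat R) *:%R (trunc n) (trunc_is_scalable n).

Lemma trunc_seriesM n f g : trunc n (f * g) = trunc n f * trunc n g.
Proof. exact: rmorphM. Qed.

Lemma trunc_seriesZ n c f : trunc n (c *: f) = c *: trunc n f.
Proof. exact: linearZ. Qed.

Lemma trunc_xvar n i : trunc n (xvar i : series nat R) = if (i < n)%N then xvar i else 0.
Proof.
apply: seriesP => mo /=; case: ifP => low; case: ifP => //= ltin; case: eqP => // mE.
  by rewrite mE low_monomU ltin in low.
by rewrite mE low_monomU ltin in low.
Qed.

Lemma trunc_isum (T : choiceType) (A : set T) (F : T -> series nat R) n :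
  trunc n (isum A F) = isum A (fun t => trunc n (F t)).
Proof. by apply: seriesP => mo /=; case: ifP => low //; rewrite fsbig1. Qed.

Lemma coef_sum (T : Type) (s : seq T) (F : T -> series nat R) mo :
  coef (\sum_(t <- s) F t) mo = \sum_(t <- s) coef (F t) mo.
Proof. by elim: s => [|x s IH]; rewrite ?big_nil // !big_cons Defs.coefD IH. Qed.

Lemma isum_finsupp (T : choiceType) (A : set T) (F : T -> series nat R) (s : seq T) :
  uniq s -> (forall t, t \in s -> A t) -> (forall t, A t -> t \notin s -> F t = 0) ->
  isum A F = \sum_(t <- s) F t.
Proof.
move=> us sA As; apply: seriesP => mo; rewrite coef_sum /= (fsbigE s) //.
  by rewrite big_seq_cond [RHS]big_seq_cond; apply: eq_bigl => t; case: (boolP (t \in s)) => //= /sA /mem_set ->.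
by move=> t At ts; rewrite As.
Qed.

Lemma trunc_prod_xvar n (s : seq nat) :
  trunc n (\prod_(i <- s) xvar i) = if all (fun i => (i < n)%N) s then \prod_(i <- s) xvar i else 0.
Proof.
rewrite rmorph_prod; elim: s => [|i s IH]; first by rewrite !big_nil.
by rewrite !big_cons IH /= trunc_xvar; case: ifP => //= _; rewrite ?mul0r //; case: ifP; rewrite ?mulr0.
Qed.

(** Splitting by membership of the largest element mirrors the recursion of [ext_elem_truncS]. *)
Fixpoint ksubsets n k : seq {fset nat} :=
  match n, k with
  | _, 0 => [:: fset0]
  | 0, _.+1 => [::]
  | n.+1, k.+1 => ksubsets n k.+1 ++ [seq (n |` A)%fset | A <- ksubsets n k]
  end.

Lemma mem_ksubsets n k (S : {fset nat}) :
  (S \in ksubsets n k) = (#|` S| == k) && all (fun i => (i < n)%N) S.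
Proof.
elim: n k S => [|n IH] [|k] S.
- rewrite inE cardfs_eq0; case: eqP => [->|] //=; apply/esym/allP => i; by rewrite inE.
- rewrite in_nil; apply/esym/negP => /andP[/eqP cS /allP h].
  by have /fset0Pn[i /h] : S != fset0 by rewrite -cardfs_gt0 cS.
- rewrite inE cardfs_eq0; case: eqP => [->|] //=; apply/esym/allP => i; by rewrite inE.
rewrite /= mem_cat IH; apply/orP/andP => [[/andP[-> /allP h]|/mapP[S' S'in ->]]|[/eqP cS /allP h]].
- by split=> //; apply/allP => i /h; lia.
- move: S'in; rewrite IH => /andP[/eqP cS /allP h]; split.
    rewrite cardfsU1 cS (_ : n \notin S' = true) //.
    by apply/negP => /h; rewrite ltnn.
  by apply/allP => i; rewrite in_fset1U => /orP[/eqP->|/h]; lia.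
have [nS|nS] := boolP (n \in S); [right|left].
  apply/mapP; exists (S `\ n)%fset; last by rewrite fsetD1K.
  rewrite IH; apply/andP; split; first by move: cS; rewrite (cardfsD1 n S) nS add1n => -[/eqP].
  by apply/allP => i; rewrite in_fsetD1 => /andP[ni /h]; move/eqP: ni; lia.
rewrite cS eqxx; apply/allP => i iS; have := h i iS; rewrite ltnS leq_eqVlt => /orP[/eqP ni|//].
by rewrite -ni iS in nS.
Qed.

Lemma ksubsets_uniq n k : uniq (ksubsets n k).
Proof.
elim: n k => [|n IH] [|k] //=; rewrite cat_uniq IH /=; apply/andP; split.
  apply/hasPn => _ /mapP[S _ ->]; rewrite mem_ksubsets negb_and; apply/orP; right.
  by apply/allPn; exists n; rewrite ?fset1U1 // ltnn.
rewrite map_inj_in_uniq // => S S'; rewrite !mem_ksubsets => /andP[_ /allP h] /andP[_ /allP h'].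
move=> eq; have nS : n \notin S by apply/negP => /h; rewrite ltnn.
have nS' : n \notin S' by apply/negP => /h'; rewrite ltnn.
by rewrite -(fsetU1K nS) eq fsetU1K.
Qed.

Definition elem_trunc n k : series nat R := trunc n (elemn k).

Lemma elem_truncE n k : elem_trunc n k = \sum_(S <- ksubsets n k) \prod_(i <- S) xvar i.
Proof.
rewrite /elem_trunc trunc_isum (@isum_finsupp _ _ _ (ksubsets n k)).
- rewrite !big_seq; apply: eq_bigr => S; rewrite mem_ksubsets => /andP[_ h].
  by rewrite trunc_prod_xvar h.
- exact: ksubsets_uniq.
- by move=> S; rewrite mem_ksubsets => /andP[/eqP].
- move=> S /= cS; rewrite mem_ksubsets cS eqxx /= => /negbTE h.
  by rewrite trunc_prod_xvar h.
Qed.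

Lemma elem_trunc0 k : elem_trunc 0 k = (k == 0%N)%:R.
Proof. by rewrite elem_truncE; case: k => [|k] /=; rewrite ?big_nil // big_seq1 big_nil. Qed.

Lemma elem_trunc_fin n k : (n < k)%N -> elem_trunc n k = 0.
Proof.
rewrite elem_truncE => nk; suff -> : ksubsets n k = [::] by rewrite big_nil.
elim: n k nk => [|n IH] [|k] //=; rewrite ltnS => nk.
by rewrite !IH // ltnW.
Qed.

Lemma ext_elem_truncS n z :
  ext (elem_trunc n.+1) z = ext (elem_trunc n) z + xvar n * ext (elem_trunc n) (z - 1).
Proof.
case: z => [[|k]|k]; rewrite /= ?mulr0 ?addr0 //.
  by rewrite !elem_truncE; case: n => [|n] /=; rewrite !big_seq1.
rewrite subn1 /= !elem_truncE /= big_cat big_map /=; congr (_ + _).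
rewrite big_distrr !big_seq; apply: eq_bigr => S; rewrite mem_ksubsets => /andP[_ /allP h].
by rewrite big_fsetU1 //; apply/negP => /h; rewrite ltnn.
Qed.

Lemma trunc_elem n z : trunc n (elem z) = ext (elem_trunc n) z.
Proof. by case: z => //= k; rewrite raddf0. Qed.

Lemma trunc_fser n z : trunc n (fser z) = corr n (elem_trunc n) z.
Proof.
rewrite /fser trunc_isum (@isum_finsupp _ _ _ [seq Posz k | k <- iota 0 n.+1]) //.
- rewrite big_map -[iota 0 n.+1]/(index_iota 0 n.+1) big_mkord; apply: eq_bigr => k _.
  by rewrite trunc_seriesM !trunc_elem.
- by rewrite map_inj_uniq ?iota_uniq // => x y [].
move=> k _ kn; rewrite trunc_seriesM !trunc_elem; case: k kn => [k|k] kn; last by rewrite mul0r.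
rewrite /= elem_trunc_fin ?mul0r // ltnNge; apply/negP => le.
by case/mapP: kn; exists k; rewrite ?mem_iota.
Qed.

Lemma trunc_eser n : trunc n eser = eval_at n (elem_trunc n) 1.
Proof.
rewrite /eser trunc_isum (@isum_finsupp _ _ _ (iota 0 n.+1)) ?iota_uniq //.
- rewrite -[iota 0 n.+1]/(index_iota 0 n.+1) big_mkord; apply: eq_bigr => k _.
  by rewrite trunc_elem expr1n mul1r.
- by move=> k _; rewrite mem_iota trunc_elem => h; rewrite /= elem_trunc_fin //; lia.
Qed.

Lemma trunc_ebarser n : trunc n ebarser = eval_at n (elem_trunc n) (-1).
Proof.
rewrite /ebarser trunc_isum (@isum_finsupp _ _ _ (iota 0 n.+1)) ?iota_uniq //.
- rewrite -[iota 0 n.+1]/(index_iota 0 n.+1) big_mkord; apply: eq_bigr => k _.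
  by rewrite trunc_seriesM trunc_elem rmorphXn rmorphN1.
- move=> k _; rewrite mem_iota trunc_seriesM trunc_elem => h.
  by rewrite /= elem_trunc_fin ?mulr0 //; lia.
Qed.

End Truncation.
(** * Tableaux and the dual Jacobi-Trudi formula *)

(* The shapes mu such that l / mu is a horizontal strip; zero rows are allowed and keep the number
   of rows constant. *)
Fixpoint strips (l : seq nat) : seq (seq nat) :=
  if l is a :: l' then
    [seq b :: mu | b <- iota (head 0%N l') (a.+1 - head 0%N l'), mu <- strips l']
  else [:: [::]].

Lemma stripsP l mu : reflect
  (size mu = size l /\ forall i, (nth 0 l i.+1 <= nth 0 mu i <= nth 0 l i)%N) (mu \in strips l).
Proof.
elim: l mu => [|a l IH] mu.
  rewrite inE; case: eqP => [->|nil]; constructor; first by split=> // i; rewrite !nth_nil.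
  by move=> [/size0nil].
apply: (iffP allpairsPdep) => [[b [mu' [bin mu'in ->]]]|[]].
  have [sz h] := IH _ mu'in; split=> [|[|i]] /=; [by rewrite sz| |exact: h].
  by move: bin; rewrite mem_iota nth0; lia.
case: mu => [//|b mu] /= [sz] h; exists b, mu; split=> //.
  by have := h 0%N; rewrite mem_iota /= nth0; lia.
by apply/IH; split=> // i; exact: (h i.+1).
Qed.

Lemma strips_uniq l : uniq (strips l).
Proof.
elim: l => //= a l IH; apply: allpairs_uniq_dep => [|b _|]; rewrite ?iota_uniq //.
by move=> _ _ /allpairsPdep[b [mu [_ _ ->]]] /allpairsPdep[b' [mu' [_ _ ->]]] /= [-> ->].
Qed.

Lemma ssytP l t : reflect
  [/\ shape t = l, forall i, sorted leq (nth [::] t i) &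
      forall i c, (i.+1 < size t)%N -> (c < size (nth [::] t i))%N -> (c < size (nth [::] t i.+1))%N ->
        (nth 0 (nth [::] t i) c < nth 0 (nth [::] t i.+1) c)%N]
  (is_ssyt l t).
Proof.
apply: (iffP and3P) => [[/eqP sh /all_nthP rows /sortedP cols]|[sh rows cols]]; split.
- by [].
- move=> i; have [it|ti] := ltnP i (size t); first exact: (rows [::]).
  by rewrite nth_default.
- move=> i c it ci ci'; have /(all_nthP (0%N, 0%N))/(_ c) := cols [::] i it.
  by rewrite nth_zip_cond size_zip leq_min ci ci' /= => ->.
- exact/eqP.
- by apply/(all_nthP [::]) => i _.
apply/(sortedP [::]) => i it; apply/(all_nthP (0%N, 0%N)) => c.
rewrite nth_zip_cond size_zip leq_min => /andP[ci ci']; rewrite ci ci' /=.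
exact: cols.
Qed.

Lemma sorted_split_max n (r : seq nat) : sorted leq r -> all (fun i => (i < n.+1)%N) r ->
  r = filter (fun i => (i < n)%N) r ++ nseq (size r - size (filter (fun i => (i < n)%N) r)) n.
Proof.
elim: r => //= a r IH sr /andP[an rn]; case: (ltnP a n) => /= lt.
  by rewrite -IH // (path_sorted sr).
have min := order_path_min leq_trans sr.
have -> : filter (fun i => (i < n)%N) r = [::].
  apply/eqP; rewrite -size_eq0 size_filter -leqn0 leqNgt -has_count; apply/hasPn => i ir.
  by rewrite -leqNgt; apply: leq_trans lt (allP min i ir).
have -> : a = n by lia.
rewrite subn0 /=; congr cons; apply/all_pred1P/allP => i ir /=.
by have := allP min i ir; have := allP rn i ir; rewrite /= => h1 h2; apply/eqP; lia.
Qed.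

Definition addmax n (l : seq nat) (t : seq (seq nat)) : seq (seq nat) :=
  mkseq (fun i => nth [::] t i ++ nseq (nth 0%N l i - size (nth [::] t i)) n) (size l).

Definition delmax n (t : seq (seq nat)) : seq (seq nat) :=
  [seq filter (fun i => (i < n)%N) r | r <- t].

Fixpoint tableaux n (l : seq nat) : seq (seq (seq nat)) :=
  if n is n'.+1 then [seq addmax n' l t | mu <- strips l, t <- tableaux n' mu]
  else if sumn l == 0%N then [:: nseq (size l) [::]] else [::].

Lemma addmaxK n l t : size t = size l -> all (all (fun i => (i < n)%N)) t ->
  delmax n (addmax n l t) = t.
Proof.
move=> sz /all_nthP tn; apply: (@eq_from_nth _ [::]); first by rewrite size_map size_mkseq.
move=> i; rewrite size_map size_mkseq => il; rewrite (nth_map [::]) ?size_mkseq // nth_mkseq //.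
rewrite filter_cat; set r := nth [::] t i.
have -> : filter (fun i => (i < n)%N) r = r by apply/all_filterP/tn; rewrite sz.
by rewrite (_ : filter _ (nseq _ _) = [::]) ?cats0 // filter_nseq ltnn.
Qed.

Lemma interlacing_sorted l mu : size mu = size l ->
  (forall i, (nth 0 l i.+1 <= nth 0 mu i <= nth 0 l i)%N) -> sorted geq mu.
Proof.
move=> sz h; apply/(sortedP 0%N) => i _ /=.
by have /andP[_ h1] := h i.+1; have /andP[h2 _] := h i; apply: leq_trans h1 h2.
Qed.

(** The branching rule: the largest letter fills row ends and has nothing below it, so the smaller
    letters form a tableau whose shape is [l] minus a horizontal strip. *)
Lemma mem_tableaux n l t : sorted geq l ->
  (t \in tableaux n l) = is_ssyt l t && all (all (fun i => (i < n)%N)) t.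
Proof.
elim: n l t => [|n IH] l t sl.
  have rows0 : all (all (fun i => (i < 0)%N)) t -> t = nseq (size t) [::].
    by move=> t0; apply/all_pred1P/allP => -[//|a r] /(allP t0).
  apply/idP/andP => [|[/ssytP[sh _ _] /rows0 tE]] /=; last first.
    have l0 : l = nseq (size t) 0%N by rewrite -sh {1}tE /shape map_nseq.
    by rewrite l0 sumn_nseq mul0n eqxx size_nseq inE -tE.
  case: eqP => // l0; rewrite inE => /eqP->; split; last by rewrite all_nseq orbT.
  apply/ssytP; split=> [|i|i c _]; rewrite ?nth_nseq ?if_same //.
  rewrite /shape map_nseq; apply/esym/all_pred1P/allP => a al /=.
  by move/eqP: l0; rewrite sumnE sum_nat_seq_eq0 => /allP/(_ a al).
apply/allpairsPdep/andP => [[mu [t' [/stripsP[szmu h] t'in ->]]]|[/ssytP[sh rows cols] tn]].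
  have smu := interlacing_sorted szmu h.
  move: t'in; rewrite IH // => /andP[/ssytP[sh rows cols] tn].
  have szt : size t' = size l by rewrite -szmu -sh size_map.
  have nthE i : nth [::] (addmax n l t') i = nth [::] t' i ++ nseq (nth 0%N l i - nth 0%N mu i) n.
    have [il|li] := ltnP i (size l); first by rewrite nth_mkseq // -nth_shape sh.
    by rewrite !nth_default ?size_mkseq ?szt ?szmu.
  have szE i : size (nth [::] t' i) = nth 0%N mu i by rewrite -nth_shape sh.
  have szE' i : size (nth [::] (addmax n l t') i) = nth 0%N l i.
    by rewrite nthE size_cat size_nseq szE subnKC //; have /andP[] := h i.
  have tni i c : (c < size (nth [::] t' i))%N -> (nth 0 (nth [::] t' i) c < n)%N.
    move=> cs; have it : (i < size t')%N by rewrite ltnNge; apply/negP => ti; rewrite nth_default in cs.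
    by have /(all_nthP [::])/(_ i it)/(all_nthP 0%N)/(_ c cs) := tn.
  split; last first.
    apply/(all_nthP [::]) => i _; apply/(all_nthP 0%N) => c; rewrite szE' nthE => cl.
    rewrite nth_cat; case: ifP => cs; first by rewrite ltnW // ltnS tni.
    by rewrite nth_nseq; case: ifP.
  apply/ssytP; split.
  - apply: (@eq_from_nth _ 0%N) => [|i _]; first by rewrite size_map size_mkseq.
    by rewrite nth_shape szE'.
  - move=> i; apply/(sortedP 0%N) => c; rewrite szE' nthE => cl.
    rewrite !nth_cat szE; case: ifP => cs; last first.
      rewrite ifF; last by lia.
      by rewrite !nth_nseq; do 2!case: ifP; lia.
    case: ifP => cs1; first by have /(sortedP 0%N)/(_ c) := rows i; rewrite szE; apply.
    rewrite nth_nseq; case: ifP; last by lia.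
    by move=> _; apply/ltnW/tni; rewrite szE.
  move=> i c _; rewrite !szE' !nthE => ci ci'; rewrite !nth_cat !szE.
  have /andP[h1 _] := h i; have cmu : (c < nth 0 mu i)%N by apply: leq_trans ci' h1.
  rewrite cmu; case: ifP => cmu'; last first.
    by rewrite nth_nseq ifT; [rewrite tni ?szE|lia].
  apply: cols; rewrite ?szE //.
  by rewrite ltnNge; apply/negP => le; rewrite nth_default -?sh ?size_map // in cmu'.
exists (shape (delmax n t)), (delmax n t).
have tni i : all (fun j => (j < n.+1)%N) (nth [::] t i).
  have [it|ti] := ltnP i (size t); first by have /(all_nthP [::])/(_ i it) := tn.
  by rewrite nth_default.
have delE i : nth [::] (delmax n t) i = filter (fun j => (j < n)%N) (nth [::] t i).
  have [it|ti] := ltnP i (size t); first by rewrite (nth_map [::]).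
  by rewrite !nth_default ?size_map.
have splitE i := sorted_split_max (rows i) (tni i).
have szt : size t = size l by rewrite -sh size_map.
have szE i : size (nth [::] t i) = nth 0%N l i by rewrite -nth_shape sh.
(* Were row i+1 longer than the part of row i below n, some entry n would have a cell beneath it,
   which needs a letter greater than n. *)
have inter i : (nth 0 l i.+1 <= nth 0 (shape (delmax n t)) i <= nth 0 l i)%N.
  rewrite nth_shape delE; apply/andP; split; last by rewrite -szE size_filter count_size.
  rewrite leqNgt; apply/negP => lt.
  set c := size _ in lt.
  have il : (i.+1 < size t)%N by rewrite szt ltnNge; apply/negP => le; rewrite nth_default in lt.
  have ci : (c < size (nth [::] t i))%N.
    rewrite szE; apply: leq_trans lt _.
    by have /(sortedP 0%N)/(_ i) := sl; apply; rewrite -szt.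
  have ci' : (c < size (nth [::] t i.+1))%N by rewrite szE.
  have := cols i c il ci ci'; rewrite [nth [::] t i]splitE nth_cat ltnn subnn nth_nseq.
  have -> : (0 < size (nth [::] t i) - c)%N by lia.
  by have /(all_nthP 0%N)/(_ c ci') := tni i.+1 => /=; lia.
have szd : size (shape (delmax n t)) = size l by rewrite !size_map szt.
split.
- exact/stripsP.
- rewrite IH; last exact: interlacing_sorted szd inter.
  apply/andP; split; last first.
    apply/(all_nthP [::]) => i _; rewrite delE; exact: filter_all.
  apply/ssytP; split=> // [i|i c id].
    by rewrite delE; apply: sorted_filter => //; exact: leq_trans.
  rewrite !delE => ci ci'.
  have pre j : (c < size (filter (fun j => (j < n)%N) (nth [::] t j)))%N ->
      nth 0%N (filter (fun j => (j < n)%N) (nth [::] t j)) c = nth 0%N (nth [::] t j) c.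
    by move=> cj; rewrite [in RHS]splitE nth_cat cj.
  rewrite !pre //; apply: cols; first by rewrite size_map in id.
    by apply: leq_trans ci _; rewrite size_filter count_size.
  by apply: leq_trans ci' _; rewrite size_filter count_size.
apply: (@eq_from_nth _ [::]) => [|i it]; first by rewrite size_mkseq.
by rewrite nth_mkseq -?szt // delE -szE -splitE.
Qed.

Lemma tableaux_uniq n l : sorted geq l -> uniq (tableaux n l).
Proof.
elim: n l => [|n IH] l sl /=; first by case: ifP.
have smu mu : mu \in strips l -> sorted geq mu.
  by move=> /stripsP[]; exact: interlacing_sorted.
apply: allpairs_uniq_dep => [|mu /smu/IH //|]; first exact: strips_uniq.
move=> _ _ /allpairsPdep[mu [t [muin tin ->]]] /allpairsPdep[mu' [t' [muin' tin' ->]]] /= eq.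
move: tin tin'; rewrite !mem_tableaux ?smu // => /andP[/ssytP[sh _ _] tn] /andP[/ssytP[sh' _ _] tn'].
have sz (nu : seq nat) (s : seq (seq nat)) : nu \in strips l -> shape s = nu -> size s = size l.
  by move=> /stripsP[<- _] <-; rewrite size_map.
have tt' : t = t'.
  rewrite -(@addmaxK n l t) ?(sz mu) // eq addmaxK //; exact: (sz mu').
by rewrite -sh -sh' tt'.
Qed.

Lemma all_flatten (T : Type) (a : pred T) (ss : seq (seq T)) :
  all a (flatten ss) = all (all a) ss.
Proof. by elim: ss => //= s ss IH; rewrite all_cat IH. Qed.

Section SchurTruncation.
Context {R : comNzRingType}.

Definition tableau_sum n l : series nat R :=
  \sum_(t <- tableaux n l) \prod_(r <- t) \prod_(i <- r) xvar i.

Lemma trunc_schur n l : is_partition l -> trunc n (schur l) = tableau_sum n l.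
Proof.
case/andP=> sl _; rewrite /schur trunc_isum (@isum_finsupp _ _ _ _ (tableaux n l)).
- rewrite /tableau_sum !big_seq; apply: eq_bigr => t; rewrite mem_tableaux // => /andP[_ tn].
  by rewrite -big_flatten trunc_prod_xvar all_flatten tn.
- exact: tableaux_uniq.
- by move=> t; rewrite mem_tableaux // => /andP[].
move=> t /= lt; rewrite mem_tableaux // lt /= => /negbTE tn.
by rewrite -big_flatten trunc_prod_xvar all_flatten tn.
Qed.

Lemma tableau_sum0 l : tableau_sum 0 l = (sumn l == 0%N)%:R.
Proof.
rewrite /tableau_sum /=; case: ifP => _; last by rewrite big_nil.
by rewrite big_seq1 big1_seq // => r /andP[_ /nseqP[-> _]]; rewrite big_nil.
Qed.

Lemma tableau_sumS n l : sorted geq l ->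
  tableau_sum n.+1 l =
  \sum_(mu <- strips l) xvar n ^+ (sumn l - sumn mu) * tableau_sum n mu.
Proof.
move=> sl; rewrite /tableau_sum /= big_allpairs_dep /= !big_seq; apply: eq_bigr => mu.
move=> /stripsP[sz h]; have smu := interlacing_sorted sz h.
rewrite big_distrr !big_seq; apply: eq_bigr => t /=; rewrite mem_tableaux // => /andP[/ssytP[sh _ _] tn].
have szt : size t = size l by rewrite -sz -sh size_map.
rewrite big_map; transitivity (\prod_(i <- iota 0 (size l))
    (xvar n ^+ (nth 0%N l i - nth 0%N mu i) * \prod_(j <- nth [::] t i) xvar j : series nat R)).
  apply: eq_bigr => i _; rewrite big_cat /= mulrC -sh nth_shape; congr (_ * _).
  by rewrite big_nseq iter_mulr_1.
rewrite big_split /=; congr (_ * _); last first.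
  by rewrite -szt [RHS](big_nth [::]) /index_iota subn0.
rewrite -expr_sum; congr (_ ^+ _).
rewrite sumnB; last by move=> i _; have /andP[] := h i.
have sumE (s : seq nat) : sumn s = (\sum_(i <- iota 0 (size s)) nth 0 s i)%N.
  by rewrite sumnE (big_nth 0%N) /index_iota subn0.
by rewrite !sumE sz.
Qed.

End SchurTruncation.

(** * Column lengths and the determinant for Schur functions *)

Definition col_len (l : seq nat) j : nat := count (fun a => (j < a)%N) l.

(** Both sides say that the cell (i, j) lies in the diagram. *)
Lemma lt_col_len l i j : sorted geq l -> (i < col_len l j)%N = (j < nth 0 l i)%N.
Proof.
elim: l i => [|a l IH] i sl; first by rewrite nth_nil.
have min : all (geq a) l by apply: order_path_min sl; move=> x y z /= xy zx; exact: leq_trans zx xy.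
rewrite /col_len /=; case: (ltnP j a) => ja; rewrite ?add1n ?add0n.
  by case: i => [|i]; rewrite /= ?ja // ltnS IH // (path_sorted sl).
have -> : count (fun a => (j < a)%N) l = 0%N.
  apply/eqP; rewrite -leqn0 leqNgt -has_count; apply/hasPn => b /(allP min) /= ba.
  by rewrite -leqNgt (leq_trans ba).
rewrite ltn0; apply/esym/negbTE; rewrite -leqNgt; case: i => [|i] //=.
have [il|li] := ltnP i (size l); last by rewrite nth_default.
by apply: leq_trans ja; apply: (allP min); apply: mem_nth.
Qed.

Lemma eq_from_ltn (a b : nat) : (forall i, (i < a)%N = (i < b)%N) -> a = b.
Proof. by move=> h; case: (ltngtP a b) => // lt; move: (h a) (h b); rewrite !ltnn lt. Qed.

Lemma col_len_anti l j k : (j <= k)%N -> (col_len l k <= col_len l j)%N.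
Proof. by move=> jk; apply: sub_count => a /=; apply: leq_ltn_trans. Qed.

Lemma col_len_size l j : (col_len l j <= size l)%N.
Proof. exact: count_size. Qed.

Definition transpose h (c : seq nat) : seq nat := mkseq (col_len c) h.

Lemma nth_transpose h c i : nth 0%N (transpose h c) i = if (i < h)%N then col_len c i else 0%N.
Proof. by case: ltnP => ih; [rewrite nth_mkseq|rewrite nth_default ?size_mkseq]. Qed.

Lemma transpose_sorted h c : sorted geq (transpose h c).
Proof.
apply/(sortedP 0%N) => i; rewrite size_mkseq => ih /=.
by rewrite !nth_transpose ih (ltnW ih); apply: col_len_anti.
Qed.

Lemma col_len_transpose h c j : sorted geq c -> (forall i, nth 0 c i <= h)%N ->
  col_len (transpose h c) j = nth 0%N c j.
Proof.
move=> sc ch; apply: eq_from_ltn => i; rewrite lt_col_len ?transpose_sorted // nth_transpose.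
case: (ltnP i h) => ih; rewrite ?ltn0 ?lt_col_len //.
by apply/esym/negbTE; rewrite -leqNgt (leq_trans (ch j)).
Qed.

Lemma sumn_col_len N l : (forall i, nth 0 l i <= N)%N ->
  sumn l = (\sum_(j < N) col_len l j)%N.
Proof.
move=> lN; rewrite /col_len; under eq_bigr do rewrite -sum1_count.
under eq_bigr do rewrite big_mkcond /=.
rewrite exchange_big sumnE !big_seq; apply: eq_bigr => a al /=.
have aN : (a <= N)%N by rewrite -(nth_index 0%N al).
rewrite -big_mkcond /= -(big_ord_widen N (fun=> 1%N)) //.
by rewrite sum_nat_const card_ord muln1.
Qed.

Section JacobiTrudi.
Context {R : comNzRingType}.

(* lambda'_(N-i) + i: the conjugate partition, padded to N columns and shifted to be strict. *)
Definition positions N (l : seq nat) (i : 'I_N) : nat := (i + col_len l (N.-1 - i))%N.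

Lemma positions_lt N l (i j : 'I_N) : (i < j)%N -> (positions l i < positions l j)%N.
Proof.
move=> ij; rewrite /positions; have := @col_len_anti l (N.-1 - j) (N.-1 - i).
by move/(_ _); lia.
Qed.

(** The inverse of [positions]: the numbers g i - i, read backwards, are the column lengths, and
    transposing them gives a shape with h rows, some possibly empty. *)
Lemma exists_positions N h (g : 'I_N -> nat) :
  (forall i j : 'I_N, (i < j)%N -> (g i < g j)%N) -> (forall i, g i <= h + i)%N ->
  exists mu, [/\ sorted geq mu, size mu = h, forall i, (nth 0 mu i <= N)%N &
    forall i, positions mu i = g i].
Proof.
move=> g_inc gh.
have gi k (kN : (k < N)%N) : (k <= g (Ordinal kN))%N.
  elim: k kN => // k IHk kN; have kN' : (k < N)%N by apply: leq_trans kN.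
  by apply: leq_ltn_trans (IHk kN') _; apply: g_inc.
have {}gi (i : 'I_N) : (i <= g i)%N by case: i => k kN; exact: gi.
pose ct j := if insub (N.-1 - j)%N is Some i then (g i - i)%N else 0%N.
have ctE (i : 'I_N) : ct (N.-1 - i)%N = (g i - i)%N.
  rewrite /ct (_ : (N.-1 - (N.-1 - i))%N = val i) ?valK //.
  by have := ltn_ord i => /=; lia.
have ct_rev j : (j < N)%N -> exists2 i : 'I_N, j = (N.-1 - i)%N & ct j = (g i - i)%N.
  move=> jN; have iN : (N.-1 - j < N)%N by lia.
  have ji : j = (N.-1 - Ordinal iN)%N by rewrite /=; lia.
  by exists (Ordinal iN) => //; rewrite -ctE -ji.
pose cs := mkseq ct N.
have scs : sorted geq cs.
  apply/(sortedP 0%N) => j; rewrite size_mkseq => jN.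
  have [i ji ci] := ct_rev _ jN; have [i' ji' ci'] := ct_rev _ (ltnW jN).
  rewrite (nth_mkseq _ _ jN) (nth_mkseq _ _ (ltnW jN)) ci ci'.
  have ii' : (i < i')%N by lia.
  have := g_inc _ _ ii'; rewrite /=; have := gi i; have := gi i'.
  by have := ltn_ord i; have := ltn_ord i'; lia.
have nth_cs j : nth 0%N cs j = if (j < N)%N then ct j else 0%N.
  by case: ltnP => jN; [rewrite nth_mkseq|rewrite nth_default ?size_mkseq].
have csE (i : 'I_N) : nth 0%N cs (N.-1 - i) = (g i - i)%N.
  by rewrite nth_cs ctE ifT //; have := ltn_ord i; lia.
have cs_le j : (nth 0 cs j <= h)%N.
  have [jN|Nj] := ltnP j N; last by rewrite nth_cs ltnNge Nj.
  by have [i ji _] := ct_rev _ jN; rewrite ji csE leq_subLR addnC.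
exists (transpose h cs); split=> [| |i|i]; rewrite ?size_mkseq //.
- exact: transpose_sorted.
- rewrite nth_transpose; case: ifP => // _.
  by apply: leq_trans (col_len_size _ _) _; rewrite size_mkseq.
by rewrite /positions col_len_transpose // csE subnKC.
Qed.

Lemma col_len_large N l j : sorted geq l -> (forall i, nth 0 l i <= N)%N -> (N <= j)%N ->
  col_len l j = 0%N.
Proof.
move=> sl lN Nj; apply/eqP; rewrite -leqn0 leqNgt lt_col_len // -leqNgt.
exact: leq_trans (lN 0%N) Nj.
Qed.

(** A horizontal strip removes at most one cell from each column. *)
Lemma strips_col_len l mu : sorted geq l -> sorted geq mu -> size mu = size l ->
  (mu \in strips l) <-> (forall j, (col_len mu j <= col_len l j <= (col_len mu j).+1)%N).
Proof.
move=> sl smu sz; split=> [/stripsP[_ h] j|h].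
  apply/andP; split; rewrite leqNgt; apply/negP; rewrite lt_col_len // => lt.
    have /andP[_ h2] := h (col_len l j); have := leq_trans lt h2.
    by rewrite -lt_col_len // ltnn.
  have /andP[h1 _] := h (col_len mu j); have := leq_trans lt h1.
  by rewrite -lt_col_len // ltnn.
apply/stripsP; split=> // i; apply/andP; split; rewrite leqNgt; apply/negP; rewrite -lt_col_len // => lt.
  have /andP[_ h2] := h (nth 0%N mu i); have := leq_trans lt h2.
  by rewrite ltnS lt_col_len // ltnn.
have /andP[h1 _] := h (nth 0%N l i); have := leq_trans lt h1.
by rewrite lt_col_len // ltnn.
Qed.

Lemma sumn_col_len_rev N l : (forall i, nth 0 l i <= N)%N ->
  sumn l = (\sum_(i < N) col_len l (N.-1 - i))%N.
Proof.
move=> lN; rewrite (sumn_col_len lN) (reindex_inj rev_ord_inj) /=.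
by apply: eq_bigr => i _; congr col_len; lia.
Qed.

Lemma jacobi_trudi0 N l : sorted geq l -> (forall i, nth 0 l i <= N)%N ->
  tableau_sum 0 l =
  ext_det (elem_trunc 0) (fun i : 'I_N => (positions l i)%:Z) :> series nat R.
Proof.
move=> sl lN; rewrite tableau_sum0.
have col0 j : nth 0%N l 0 = 0%N -> col_len l j = 0%N.
  by move=> h; apply/eqP; rewrite -leqn0 leqNgt lt_col_len // -leqNgt h.
have [l0|l0] := posnP (nth 0%N l 0).
  rewrite (sumn_col_len lN) big1 => [|j _]; last exact: col0.
  rewrite /ext_det (_ : \matrix_(i, j) _ = 1%:M) ?det1 //.
  apply/matrixP => i j; rewrite !mxE /positions col0 // addn0.
  have -> : (i == j) = (i%:Z - j%:Z == 0) by rewrite subr_eq0 eqz_nat.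
  by case: (i%:Z - j%:Z) => k //=; rewrite elem_trunc0.
have N0 : (0 < N)%N by apply: leq_trans (lN 0%N).
have -> : (sumn l == 0%N) = false.
  apply/negbTE; rewrite sumnE sum_nat_seq_eq0; apply/allPn; exists (nth 0%N l 0).
    by apply: mem_nth; rewrite ltnNge; apply/negP => le; rewrite nth_default in l0.
  by rewrite /= -lt0n.
have iN : (N.-1 < N)%N by rewrite ltn_predL.
rewrite (@ext_det_big _ _ 0 _ _ (Ordinal iN)) // => [k|]; first exact: elem_trunc_fin.
have : (0 < col_len l 0)%N by rewrite lt_col_len.
by rewrite /positions /= subnn; lia.
Qed.

(** Induction on the number of variables: lowering a row of the determinant removes a cell from a
    column. Choices that do not come from a horizontal strip give a zero determinant; the others
    reproduce [tableau_sumS]. *)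
Lemma jacobi_trudi n N l : sorted geq l -> (forall i, nth 0 l i <= N)%N ->
  tableau_sum n l =
  ext_det (elem_trunc n) (fun i : 'I_N => (positions l i)%:Z) :> series nat R.
Proof.
elim: n l => [|n IH] l sl lN; first exact: jacobi_trudi0.
rewrite tableau_sumS // (ext_det_expand _ (ext_elem_truncS n)).
pose S (mu : seq nat) : {ffun 'I_N -> bool} :=
  [ffun i : 'I_N => col_len mu (N.-1 - i) != col_len l (N.-1 - i)].
pose F (T : {ffun 'I_N -> bool}) : series nat R := xvar n ^+ (\sum_i T i) *
  ext_det (elem_trunc n) (fun i : 'I_N => (positions l i)%:Z - (T i)%:Z).
have inter mu : mu \in strips l -> [/\ size mu = size l, sorted geq mu, (forall i, nth 0 mu i <= N)%N &
    forall j, (col_len mu j <= col_len l j <= (col_len mu j).+1)%N].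
  move=> muin; have /stripsP[sz h] := muin; have smu := interlacing_sorted sz h.
  split=> //; last exact/strips_col_len.
  by move=> i; apply: leq_trans (lN i); have /andP[] := h i.
have FS mu : mu \in strips l -> F (S mu) = xvar n ^+ (sumn l - sumn mu) * tableau_sum n mu.
  move=> /inter[sz smu muN h].
  have SE i : (S mu i : nat) = (col_len l (N.-1 - i) - col_len mu (N.-1 - i))%N.
    by have := h (N.-1 - i)%N; rewrite ffunE; case: eqP => /=; lia.
  rewrite /F (IH _ smu muN); congr (_ ^+ _ * _).
    rewrite (sumn_col_len_rev lN) (sumn_col_len_rev muN) -sumnB => [|i _].
      by apply: eq_bigr => i _; rewrite SE.
    by have /andP[] := h (N.-1 - i)%N.
  apply: eq_ext_det => i; rewrite SE /positions; have := h (N.-1 - i)%N.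
  by lia.
transitivity (\sum_(mu <- strips l) F (S mu)).
  by rewrite !big_seq; apply: eq_bigr => mu /FS.
have Sinj : {in strips l &, injective S}.
  move=> mu mu' /inter[sz smu muN h] /inter[sz' smu' muN' h'] /ffunP eqS.
  have eqc j : col_len mu j = col_len mu' j.
    have [jN|Nj] := ltnP j N; last by rewrite !(@col_len_large N).
    have iN : (N.-1 - j < N)%N by lia.
    have := eqS (Ordinal iN); rewrite !ffunE /= (_ : (N.-1 - (N.-1 - j))%N = j); last by lia.
    by have := h j; have := h' j; do 2!case: eqP => //=; lia.
  apply: (@eq_from_nth _ 0%N) => [|i _]; first by rewrite sz.
  by apply: eq_from_ltn => j; rewrite -!lt_col_len // eqc.
rewrite -(big_map S xpredT F) big_uniq ?map_inj_in_uniq ?strips_uniq //=.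
rewrite [RHS](bigID (mem [seq S mu | mu <- strips l])) /= [X in _ = _ + X]big1 ?addr0 // => T.
(* A choice with nonzero determinant keeps the rows nonnegative and increasing, hence belongs to a
   shape [mu] and equals [S mu]. *)
apply: contraNeq => nz.
have posB (i : 'I_N) : (positions l i < (N + size l).+1)%N.
  by rewrite /positions; have := ltn_ord i; have := col_len_size l (N.-1 - i); lia.
pose q (i : 'I_N) : 'I_(N + size l).+1 := Ordinal (posB i).
have sq : strict q by apply/strictP => i j; exact: positions_lt.
have {nz} nz : ext_det (elem_trunc n : nat -> series nat R) (fun i => (q i)%:Z - (T i)%:Z) <> 0.
  by move=> z; rewrite z mulr0 eqxx in nz.
have [/= h1 h2] := ext_det_sub sq nz.
have gB (i : 'I_N) : (positions l i - T i <= size l + i)%N.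
  by rewrite /positions; have := col_len_size l (N.-1 - i); lia.
have [mu [smu szmu muN pmu]] := exists_positions h2 gB.
have col_mu (i : 'I_N) : (T i <= col_len l (N.-1 - i))%N /\
    col_len mu (N.-1 - i) = (col_len l (N.-1 - i) - T i)%N.
  by have := h1 i; have := pmu i; rewrite /positions; lia.
apply/mapP; exists mu.
  apply/strips_col_len => // j; have [jN|Nj] := ltnP j N; last by rewrite !(@col_len_large N).
  have iN : (N.-1 - j < N)%N by lia.
  have ji : j = (N.-1 - Ordinal iN)%N by rewrite /=; lia.
  by rewrite ji; have [] := col_mu (Ordinal iN); case: (T _) => /=; lia.
apply/ffunP => i; rewrite ffunE; have [] := col_mu i => + ->.
by case: (T i) => /=; [move=> ?; apply/esym/eqP; lia | rewrite subn0 eqxx].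
Qed.

End JacobiTrudi.
(** * Summation over partitions *)

Lemma col_len0 l : is_partition l -> col_len l 0 = size l.
Proof.
move=> /andP[_ l0]; apply/eqP; rewrite -all_count; apply/allP => a al /=.
by rewrite lt0n; apply: contraNneq l0 => <-.
Qed.

Lemma nth_le_largest l i : sorted geq l -> (nth 0 l i <= largest_part l)%N.
Proof.
move=> sl; rewrite leqNgt -lt_col_len //; apply/negP => lt.
have : (0 < col_len l (largest_part l))%N by apply: leq_ltn_trans lt.
by rewrite lt_col_len // nth0 ltnn.
Qed.

Lemma positions_inj N l l' : (0 < N)%N -> is_partition l -> is_partition l' ->
  (largest_part l <= N)%N -> (largest_part l' <= N)%N ->
  (forall i : 'I_N, positions l i = positions l' i) -> l = l'.
Proof.
move=> N0 pl pl' lN l'N eqp; have /andP[sl _] := pl; have /andP[sl' _] := pl'.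
have nN i : (nth 0 l i <= N)%N by apply: leq_trans lN; exact: nth_le_largest.
have nN' i : (nth 0 l' i <= N)%N by apply: leq_trans l'N; exact: nth_le_largest.
have eqc j : col_len l j = col_len l' j.
  have [jN|Nj] := ltnP j N; last by rewrite !(@col_len_large N).
  have iN : (N.-1 - j < N)%N by lia.
  have := eqp (Ordinal iN); rewrite /positions /= (_ : (N.-1 - (N.-1 - j))%N = j); last by lia.
  by lia.
apply: (@eq_from_nth _ 0%N) => [|i _]; first by rewrite -!col_len0.
by apply: eq_from_ltn => j; rewrite -!lt_col_len // eqc.
Qed.

Lemma odd_cols_sum N l : sorted geq l -> (largest_part l <= N)%N ->
  odd_cols l = (\sum_(j < N) odd (col_len l j))%N.
Proof.
move=> sl lN; rewrite /odd_cols /conj_part -sum1_count big_map big_mkcond /=.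
rewrite (iotaDl 1 0) big_map.
transitivity (\sum_(j < largest_part l) odd (col_len l j))%N.
  rewrite -(big_mkord xpredT (fun j => nat_of_bool (odd (col_len l j)))) /index_iota subn0.
  by apply: eq_bigr => j _; rewrite /col_len add1n; case: (odd _).
rewrite (big_ord_widen N (fun j => nat_of_bool (odd (col_len l j)))) // big_mkcond /=.
apply: eq_bigr => j _; case: ltnP => // lj.
by rewrite (@col_len_large (largest_part l)) // => i; exact: nth_le_largest.
Qed.

Section PartitionSum.
Context {R : comNzRingType}.

(** In n variables only partitions with at most n rows survive, and their positions are below N + n;
    conversely every strict sequence comes from a partition, here [part q]. *)
Lemma trunc_partition_sum N n b (cf : seq nat -> R) : (0 < N)%N -> (N + n)%N = b.+1 ->
  exists part : {ffun 'I_N -> 'I_b.+1} -> seq nat,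
  (forall q : {ffun 'I_N -> 'I_b.+1}, strict q ->
     [/\ is_partition (part q), (largest_part (part q) <= N)%N &
         forall i : 'I_N, positions (part q) i = q i]) /\
  trunc n (\isum_(l \in [set l | is_partition l /\ (largest_part l <= N)%N]) (cf l *: schur l)) =
  \sum_(q : {ffun 'I_N -> 'I_b.+1} | strict q)
    cf (part q) *: ext_det (elem_trunc n) (fun i => (q i)%:Z).
Proof.
move=> N0 bE; have iN : (N.-1 < N)%N by rewrite ltn_predL.
have ex (q : {ffun 'I_N -> 'I_b.+1}) : exists l, strict q ->
     [/\ is_partition l, (largest_part l <= N)%N & forall i : 'I_N, positions l i = q i].
  have [sq|_] := boolP (strict q); last by exists [::].
  have q_inc (i j : 'I_N) : (i < j)%N -> (q i < q j)%N by rewrite (strict_mono sq).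
  (* Strictness costs at least 1 per step, so the last position bounds all column lengths and yields
     the number of rows. *)
  have qmax d (i : 'I_N) : (N.-1 - i <= d)%N -> (q i + (N.-1 - i) <= q (Ordinal iN))%N.
    elim: d i => [|d IH] i di.
      rewrite (_ : i = Ordinal iN) /= ?subnn ?addn0 //; apply/val_inj => /=.
      by have := ltn_ord i; lia.
    have [iN'|Ni] := ltnP i.+1 N; last first.
      rewrite (_ : i = Ordinal iN) /= ?subnn ?addn0 //; apply/val_inj => /=.
      by have := ltn_ord i; lia.
    have lt : (q i < q (Ordinal iN'))%N by apply: q_inc.
    have dle : (N.-1 - Ordinal iN' <= d)%N by rewrite /=; lia.
    by have /= := IH _ dle; lia.
  have h0 : (forall i : 'I_N, q i <= (q (Ordinal iN) - N.-1) + i)%N.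
    by move=> i; have := qmax _ i (leqnn _); have := ltn_ord i; lia.
  have [mu [smu szmu muN pmu]] := exists_positions q_inc h0.
  exists mu => _; split=> //; last by rewrite /largest_part -nth0.
  (* The number of rows was taken equal to the first column length, so no row is empty. *)
  rewrite /is_partition smu; apply/negP => /(nthP 0%N)[i].
  rewrite szmu => lt mui; have := pmu (Ordinal iN); rewrite /positions /= subnn => pE.
  have : (i < col_len mu 0)%N by lia.
  by rewrite lt_col_len // mui.
have [part hpart] := fin_all_exists ex.
exists part; split=> //.
have JT l : is_partition l -> (largest_part l <= N)%N -> trunc n (schur l) =
   ext_det (elem_trunc n) (fun i : 'I_N => (positions l i)%:Z) :> series nat R.
  move=> pl lN; have /andP[sl _] := pl; rewrite trunc_schur // (@jacobi_trudi _ n N) // => i.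
  by apply: leq_trans lN; exact: nth_le_largest.
rewrite trunc_isum (@isum_finsupp _ _ _ _ [seq part q | q <- enum [pred q : {ffun 'I_N -> 'I_b.+1} | strict q]]).
- rewrite big_map big_enum /=; apply: eq_bigr => q sq; have [pl lN pq] := hpart q sq.
  by rewrite trunc_seriesZ (JT _ pl lN); congr (_ *: _); apply: eq_ext_det => i; rewrite pq.
- rewrite map_inj_in_uniq ?enum_uniq // => q q'; rewrite !mem_enum => /hpart[_ _ pq] /hpart[_ _ pq'] eq.
  by apply/ffunP => i; apply/val_inj; rewrite /= -pq -pq' eq.
- by move=> l /mapP[q]; rewrite mem_enum => /hpart[pl lN _] ->.
suff zero (l : seq nat) : is_partition l -> (largest_part l <= N)%N ->
    l \notin [seq part q | q <- enum [pred q : {ffun 'I_N -> 'I_b.+1} | strict q]] ->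
    trunc n (cf l *: schur l) = 0 by move=> l [pl lN]; exact: zero.
move=> pl lN nin; rewrite trunc_seriesZ (JT _ pl lN).
(* With more than n rows the last position is at least N + n, and that row of the determinant is
   zero. *)
have [ln|nl] := leqP (size l) n; last first.
  rewrite (@ext_det_big _ _ n _ _ (Ordinal iN)) ?scaler0 // => [k|]; first exact: elem_trunc_fin.
  rewrite /positions /= subnn col_len0 //; lia.
case/negP: nin.
have lt (i : 'I_N) : (positions l i < b.+1)%N.
  by rewrite /positions; have := ltn_ord i; have := col_len_size l (N.-1 - i); lia.
pose q := [ffun i : 'I_N => Ordinal (lt i)].
have sq : strict q by apply/strictP => i j ij; rewrite !ffunE /=; exact: positions_lt.
have [pl' lN' pq] := hpart q sq.
apply/mapP; exists q; first by rewrite mem_enum.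
by apply: (positions_inj N0) => // i; rewrite pq ffunE.
Qed.

End PartitionSum.

(** * Power series over the rational polynomials in u *)

Section RationalCoefficients.
Local Notation K := {poly rat}.
Local Notation S := (series nat K).
Let u : S := 'X *: 1.

Lemma series_torsion_free k (x : S) : x *+ k.+1 = 0 -> x = 0.
Proof.
move=> x0; apply: seriesP => mo.
have coefMn j : coef (x *+ j) mo = coef x mo *+ j.
  by elim: j => [|j IH]; rewrite ?mulr0n // !mulrS Defs.coefD IH.
have := coefMn k.+1; rewrite x0 => /esym /eqP.
by rewrite -scaler_nat scaler_eq0 pnatr_eq0 /= => /eqP.
Qed.

Lemma series_lregX : GRing.lreg u.
Proof.
move=> x y; rewrite /u -!scalerAl !mul1r => xy; apply: seriesP => mo.
have /(congr1 (fun f => coef f mo)) : 'X *: x = 'X *: y by [].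
by rewrite !Defs.coefZ => /(mulfI _)->//; rewrite polyX_eq0.
Qed.

Lemma scaleX k (f : S) : 'X^k *: f = u ^+ k * f.
Proof. by rewrite /u exprZn expr1n -scalerAl mul1r. Qed.

Lemma trunc_bounded_sum n m t b N (sigma : 'I_t -> S) (eta : K) (cf : seq nat -> K) :
  N = (m + (m + t))%N -> (0 < N)%N -> (N + n = b.+1)%N ->
  (forall s, sigma s * sigma s = 1) -> \prod_s sigma s = eta *: 1 ->
  (forall l, cf l = 'X^(odd_cols l) + eta * 'X^(N - odd_cols l)) ->
  trunc n (\isum_(l \in [set l | is_partition l /\ (largest_part l <= N)%N]) (cf l *: schur l)) =
  alt_sum m b.+2 sigma (adjoin u (elem_trunc n)).
Proof.
move=> -> N0 Nb sigma2 eta_sigma cfE.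
rewrite (@alt_sum_adjoin _ _ n) => [|k|]; [|exact: elem_trunc_fin|by rewrite Nb].
have [part [hpart ->]] := trunc_partition_sum cf N0 Nb.
apply: eq_bigr => q sq; have [pl lN pq] := hpart q sq; have /andP[sl _] := pl.
(* Position i is i plus a column length, so its parity differs from that of i exactly when the
   column is odd; for [true] exactly the other rows are defective. *)
have cE : odd_cols (part q) = (\sum_i defect false q i)%N.
  rewrite (odd_cols_sum sl lN) (reindex_inj rev_ord_inj) /=; apply: eq_bigr => i _.
  rewrite /defect -pq /positions oddD.
  rewrite (_ : (m + (m + t) - i.+1)%N = ((m + (m + t)).-1 - i)%N); last by lia.
  by case: (odd i); case: (odd (col_len _ _)).
have cE' : (m + (m + t) - odd_cols (part q))%N = (\sum_i defect true q i)%N.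
  rewrite cE -[X in (X - _)%N]card_ord -sum1_card -sumnB => [|i _]; last by case: (defect _ _ _).
  apply: eq_bigr => i _; rewrite /defect; by case: (odd (q i)); case: (odd i).
rewrite cfE scalerDl -scalerA !scaleX big_bool /= -cE -cE' expr1 expr0 mul1r eta_sigma addrC mulrDl.
by rewrite -!scalerAl mul1r.
Qed.

(** A monomial involves finitely many variables, so each coefficient survives in some truncation. *)
Lemma eq_trunc (f g : S) : (forall n, trunc n f = trunc n g) -> f = g.
Proof.
move=> eq; apply: seriesP => mo; pose n := (\max_(i <- finsupp mo) i.+1)%N.
have low : low_monom n mo.
  apply/asboolP => i; rewrite leqNgt => /negP ni; apply/eqP; rewrite cmE_eq0.
  by apply/negP => imo; apply: ni; apply: leq_bigmax_seq.
by rewrite -(coef_trunc f low) eq coef_trunc.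
Qed.

Lemma trunc_det1 n m (A : nat -> nat -> S) :
  trunc n (Defs.det1 m A) = \det (\matrix_(i < m, j < m) trunc n (A i.+1 j.+1)).
Proof.
by rewrite /Defs.det1 -det_map_mx; congr (\det _); apply/matrixP => i j; rewrite !mxE.
Qed.

Lemma trunc_refined_sum n m t (sgn : S) (eta : K) (cf : nat -> K) (D : nat -> S) :
  (forall k, cf k = 'X^k + eta * 'X^(2 * m + t - k)) ->
  (forall k, (k <= m)%N -> trunc n (D k) = refined_det n (elem_trunc n) m t sgn k) ->
  trunc n (\sum_(0 <= k < m.+1) cf k *: D k) =
  refined_sum u n (elem_trunc n) m t sgn (eta *: 1).
Proof.
move=> cfE DE; rewrite big_mkord rmorph_sum; apply: eq_bigr => k _ /=.
rewrite trunc_seriesZ DE; last by rewrite -ltnS.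
by rewrite cfE scalerDl -scalerA !scaleX mulrDl -!scalerAl mul1r.
Qed.

End RationalCoefficients.
(** The values of (m, t, sgn, eta) are (w, 0, 1, 1), (w-1, 2, -1, -1), (w, 1, -1, 1) and (w, 1, 1,
    -1). The first identity asks for w > 0: at w = 0 its left side is 2 and its right side 1. *)
Theorem theorem1p3 (w : nat) :
  let u : {poly rat} := 'X in
  let c := odd_cols in
  let s : seq nat -> series nat {poly rat} := schur in
  let f : int -> series nat {poly rat} := fser in
  let e : series nat {poly rat} := eser in
  let ebar : series nat {poly rat} := ebarser in
  let Par (b : nat) : set (seq nat) :=
    [set l | is_partition l /\ (largest_part l <= b)%N] in
  [/\ (0 < w)%N ->
      \isum_(l \in Par (2 * w)%N) ((u ^+ c l + u ^+ (2 * w - c l)) *: s l) =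
      (2^-1)%:P *: \sum_(0 <= k < w.+1) (u ^+ k + u ^+ (2 * w - k)) *:
        \det_(1 <= i, j <= w)
          (if (i <= w - k)%N
           then f (i%:Z - j%:Z) + f (i%:Z + j%:Z - 2)
           else f (i%:Z - j%:Z + 1) + f (i%:Z + j%:Z - 1)),
      \isum_(l \in Par (2 * w)%N) ((u ^+ c l - u ^+ (2 * w - c l)) *: s l) =
      e * ebar * \sum_(0 <= k < w) (u ^+ k - u ^+ (2 * w - k)) *:
        \det_(1 <= i, j <= w.-1)
          (if (i <= w - k - 1)%N
           then f (i%:Z - j%:Z) - f (i%:Z + j%:Z)
           else f (i%:Z - j%:Z + 1) - f (i%:Z + j%:Z + 1)),
      \isum_(l \in Par (2 * w + 1)%N)
        ((u ^+ c l + u ^+ (2 * w + 1 - c l)) *: s l) =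
      e * \sum_(0 <= k < w.+1) (u ^+ k + u ^+ (2 * w + 1 - k)) *:
        \det_(1 <= i, j <= w)
          (if (i <= w - k)%N
           then f (i%:Z - j%:Z) - f (i%:Z + j%:Z - 1)
           else f (i%:Z - j%:Z + 1) - f (i%:Z + j%:Z))
    & \isum_(l \in Par (2 * w + 1)%N)
        ((u ^+ c l - u ^+ (2 * w + 1 - c l)) *: s l) =
      ebar * \sum_(0 <= k < w.+1) (u ^+ k - u ^+ (2 * w + 1 - k)) *:
        \det_(1 <= i, j <= w)
          (if (i <= w - k)%N
           then f (i%:Z - j%:Z) + f (i%:Z + j%:Z - 1)
           else f (i%:Z - j%:Z + 1) + f (i%:Z + j%:Z))].
Proof.
move=> u c s f e ebar Par; rewrite {}/u {}/c {}/s {}/f {}/e {}/ebar {}/Par.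
pose S := series nat {poly rat}; pose u : S := 'X *: 1.
have e_fin n k : (n < k)%N -> elem_trunc n k = 0 :> S by exact: elem_trunc_fin.
have tf := series_torsion_free.
have ureg : GRing.lreg u := series_lregX.
have corr_trunc n z : trunc n (fser z) = corr n (elem_trunc n) z :> S := trunc_fser n z.
have minus1 (x : {poly rat}) : - x = -1 * x by rewrite mulN1r.
split=> [w0| | |].
- apply: eq_trunc => n; have bE : (2 * w + n = (2 * w + n).-1.+1)%N by lia.
  have no (i : 'I_0) (P : Prop) : P by case: i.
  have half (x y : S) : x *+ 2 = y -> x = (2^-1)%:P *: y.
    by move=> <-; rewrite -scaler_nat scalerA -polyC_natr -polyCM mulVf ?scale1r.
  rewrite trunc_seriesZ; apply: half.
  rewrite (@trunc_bounded_sum n w 0 (2 * w + n).-1 (2 * w) (fun=> 1) 1).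
  + rewrite (@trunc_refined_sum n w 0 1 1).
    * by rewrite (refined_alternating0 tf ureg (e_fin n)) ?scale1r //; lia.
    * by move=> k; rewrite mul1r addn0.
    move=> k kw; rewrite trunc_det1; congr (\det _); apply/matrixP => i j; rewrite !mxE.
    rewrite mul1r; case: ifP => _; rewrite raddfD /= !corr_trunc; congr (corr _ _ _ + corr _ _ _); lia.
  + by lia.
  + by lia.
  + exact: bE.
  + by move=> i; apply: (no i).
  + by rewrite big_ord0 scale1r.
  by move=> l; rewrite mul1r.
(* For w = 0 there is no size w - 1 to work with; the right side is an empty sum, and on the left
   all weights are 1 - 1. *)
- case: w => [|w].
    rewrite big_geq // mulr0 (@isum_finsupp _ _ _ _ [::]) ?big_nil // => l [_].
    rewrite muln0 leqn0 => /eqP l0 _.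
    by rewrite /odd_cols /conj_part l0 /= subrr scale0r.
  apply: eq_trunc => n; have bE : (2 * w.+1 + n = (2 * w.+1 + n).-1.+1)%N by lia.
  rewrite !trunc_seriesM trunc_eser trunc_ebarser.
  rewrite (@trunc_bounded_sum n w 2 (2 * w.+1 + n).-1 (2 * w.+1) (fun i => (-1) ^+ i) (-1)).
  + rewrite (@trunc_refined_sum n w 2 (-1) (-1)).
    * by rewrite (refined_alternating2 tf ureg (e_fin n)) ?scaleN1r //; lia.
    * by move=> k; rewrite minus1; congr (_ + _ * _ ^+ _); lia.
    move=> k kw; rewrite trunc_det1; congr (\det _); apply/matrixP => i j; rewrite !mxE.
    have -> : (i.+1 <= w.+1 - k - 1)%N = (i < w - k)%N by lia.
    rewrite mulN1r; case: ifP => _; rewrite raddfB /= !corr_trunc; congr (corr _ _ _ - corr _ _ _); lia.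
  + by lia.
  + by lia.
  + exact: bE.
  + by move=> i; rewrite -expr2 sqrr_sign.
  + by rewrite !big_ord_recl big_ord0 /= expr0 expr1 mul1r mulr1 scaleN1r.
  by move=> l; rewrite minus1.
- apply: eq_trunc => n; have bE : (2 * w + 1 + n = (2 * w + 1 + n).-1.+1)%N by lia.
  rewrite trunc_seriesM trunc_eser.
  rewrite (@trunc_bounded_sum n w 1 (2 * w + 1 + n).-1 (2 * w + 1) (fun=> 1) 1).
  + rewrite (@trunc_refined_sum n w 1 (-1) 1).
    * by rewrite (refined_alternating1 tf ureg (e_fin n)) ?scale1r ?mulr1 //; lia.
    * by move=> k; rewrite mul1r.
    move=> k kw; rewrite trunc_det1; congr (\det _); apply/matrixP => i j; rewrite !mxE.
    rewrite mulN1r; case: ifP => _; rewrite raddfB /= !corr_trunc; congr (corr _ _ _ - corr _ _ _); lia.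
  + by lia.
  + by lia.
  + exact: bE.
  + by move=> i; rewrite mulr1.
  + by rewrite big_ord1 scale1r.
  by move=> l; rewrite mul1r.
apply: eq_trunc => n; have bE : (2 * w + 1 + n = (2 * w + 1 + n).-1.+1)%N by lia.
rewrite trunc_seriesM trunc_ebarser.
rewrite (@trunc_bounded_sum n w 1 (2 * w + 1 + n).-1 (2 * w + 1) (fun=> -1) (-1)).
+ rewrite (@trunc_refined_sum n w 1 1 (-1)).
  * by rewrite (refined_alternating1 tf ureg (e_fin n)) ?opprK ?scaleN1r ?mulrNN ?mulr1 //; lia.
  * by move=> k; rewrite minus1.
  move=> k kw; rewrite trunc_det1; congr (\det _); apply/matrixP => i j; rewrite !mxE.
  rewrite mul1r; case: ifP => _; rewrite raddfD /= !corr_trunc; congr (corr _ _ _ + corr _ _ _); lia.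
+ by lia.
+ by lia.
+ exact: bE.
+ by move=> i; rewrite mulrNN mulr1.
+ by rewrite big_ord1 scaleN1r.
by move=> l; rewrite minus1.
Qed.
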